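(* Let $G=(X,E)$ be a finite connected graph and $x,y,z\in X$ three distinct vertices with $a=d(x,y)\le b=d(x,z)\le c=d(y,z)$. Assume the three vertices are pairwise $c$-cospectral, and let $W=\chi_{\{x,y,z\}}$ ($W=1$ at $x,y,z$ and $0$ elsewhere), $H=\Delta-QW$. Then: (1) If $a<b\le c$, there is perfect tunneling between $x$ and $y$ ($TC(x,y)=TC(y,x)=1$) with tunneling time $\Theta(Q^{a-1})$, and there is no tunneling to or from $z$ ($TC(u,z)=TC(z,u)=0$ for $u\in\{x,y\}$). (2) If $a=b<c$ and the particle is started from $x$, it never tunnels perfectly to a single other state ($TC(x,y)<1$ and $TC(x,z)<1$), but it does tunnel to a mixed state of $y$ and $z$; this happens on the time scale $t\sim Q^{a-1}$. (3) If $a=b<c$ and the particle is started from $y$, then $TC(y,z)=1$ if and only if $c_{xy}=c_{xz}$; in that case the tunneling time is $\Theta(Q^{a-1})$.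
   Context: $G=(X,E)$ is a finite connected graph, $d_v$ the degree of $v$, $d(\cdot,\cdot)$ graph distance. The symmetrized Laplacian $\Delta$ has $\Delta(v,v)=1$, $\Delta(v,w)=-1/\sqrt{d_vd_w}$ if $vw\in E$, $0$ otherwise; $H=\Delta-QW$ with $W$ viewed as a diagonal matrix and $Q$ a real parameter. Starting from vertex $u$, the state is $\varphi_t=e^{itH}\chi_u$ ($\chi_u$ the indicator vector of $u$), depending on $Q$. $TC(u,v)=\liminf_{Q\to\infty}\sup_{t\in[0,\infty)}|\varphi_t(v)|^2$; perfect tunneling means $TC=1$, no tunneling $TC=0$. Tunneling from $u$ to $v$ happens within time $f(Q)$ if $TC(u,v)=\liminf_{Q\to\infty}\sup_{t\in[0,f(Q)]}|\varphi_t(v)|^2$; ''tunneling time $\Theta(g(Q))$'' means tunneling happens within some time $f(Q)=O(g(Q))$ and not within any time $f(Q)=o(g(Q))$. $PR(v,k)$ is the probability that simple random walk from $v$ is at $v$ at time $k$; $x,y$ are $m$-cospectral if $PR(x,k)=PR(y,k)$ for $0\le k\le m$. For vertices $u,v$, $c_{uv}=\sum_{P}\prod_{j=0}^{|P|-1}1/\sqrt{d_{x_j}d_{x_{j+1}}}$, the sum over all paths $P: u=x_0,x_1,\dots,x_l=v$ of length $|P|=l=d(u,v)$. *)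

(* Defs.v *)
From HB Require Import structures.
From mathcomp Require Import all_boot all_order all_algebra.
From mathcomp Require Import all_classical all_reals all_analysis.
Set Implicit Arguments. Unset Strict Implicit. Unset Printing Implicit Defensive.
Import Order.TTheory GRing.Theory Num.Theory numFieldNormedType.Exports.
Local Open Scope classical_set_scope.
Local Open Scope ring_scope.

Section Graph.
Variable n : nat.
Variable e : rel 'I_n.

Definition simple_graph := symmetric e /\ irreflexive e.
Definition connected_graph := forall u v : 'I_n, connect e u v.

Definition deg (v : 'I_n) : nat := #|[set w | e v w]|.

Definition walkb (l : nat) (u v : 'I_n) : bool :=
  [exists s : l.-tuple 'I_n, path e u s && (last u s == v)].

(* graph distance (for a connected graph the minimum is attained below n) *)
Definition gdist (u v : 'I_n) : nat := find (fun l => walkb l u v) (iota 0 n).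

Variable R : realType.

Definition laplacian : 'M[R]_n :=
  \matrix_(i, j) (if i == j then 1
                  else if e i j then - (Num.sqrt ((deg i)%:R * (deg j)%:R))^-1
                  else 0).

Definition potW (S : seq 'I_n) : 'M[R]_n :=
  \matrix_(i, j) (if (i == j) && (i \in S) then 1 else 0).

Definition ham (S : seq 'I_n) (Q : R) : 'M[R]_n := laplacian - Q *: potW S.

(* phi_t = e^{itH} chi_u ; phi_t(v) = (e^{itH})_{vu}
   = sum_k (it)^k/k! (H^k)_{vu}, split into real and imaginary parts *)
Definition amp_re (H : 'M[R]_n) (u v : 'I_n) (t : R) : R :=
  limn (fun N => \sum_(k < N)
          (-1) ^+ k * t ^+ (k.*2) / (k.*2)`!%:R * (H ^+ (k.*2)) v u).
Definition amp_im (H : 'M[R]_n) (u v : 'I_n) (t : R) : R :=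
  limn (fun N => \sum_(k < N)
          (-1) ^+ k * t ^+ (k.*2.+1) / (k.*2.+1)`!%:R * (H ^+ (k.*2.+1)) v u).

Definition prob (H : 'M[R]_n) (u v : 'I_n) (t : R) : R :=
  amp_re H u v t ^+ 2 + amp_im H u v t ^+ 2.

Definition TCgen (p : R -> R -> R) : \bar R :=
  limf_einf (fun Q => ereal_sup [set (p Q t)%:E | t in [set t | 0 <= t]])
            (pinfty_nbhs R).
Definition TCwithin_gen (p : R -> R -> R) (f : R -> R) : \bar R :=
  limf_einf (fun Q => ereal_sup [set (p Q t)%:E | t in [set t | 0 <= t <= f Q]])
            (pinfty_nbhs R).

Definition bigO (f g : R -> R) : Prop :=
  exists C M : R, forall Q, M <= Q -> `|f Q| <= C * `|g Q|.
Definition littleo (f g : R -> R) : Prop :=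
  forall eps : R, 0 < eps -> exists M : R, forall Q, M <= Q -> `|f Q| <= eps * `|g Q|.

Definition tunnel_time_gen (p : R -> R -> R) (g : R -> R) : Prop :=
  (exists f, bigO f g /\ TCgen p = TCwithin_gen p f) /\
  (forall f, littleo f g -> TCgen p <> TCwithin_gen p f).

Definition TC (S : seq 'I_n) (u v : 'I_n) : \bar R :=
  TCgen (fun Q t => prob (ham S Q) u v t).
Definition tunnel_time (S : seq 'I_n) (u v : 'I_n) (g : R -> R) : Prop :=
  tunnel_time_gen (fun Q t => prob (ham S Q) u v t) g.

Definition srw : 'M[R]_n :=
  \matrix_(i, j) (if e i j then ((deg i)%:R)^-1 else 0).
Definition PR (v : 'I_n) (k : nat) : R := (srw ^+ k) v v.
Definition cospectral (m : nat) (u v : 'I_n) : Prop :=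
  forall k, (k <= m)%N -> PR u k = PR v k.

Definition cpath (u v : 'I_n) : R :=
  \sum_(s : (gdist u v).-tuple 'I_n | path e u s && (last u s == v))
    \prod_(j < gdist u v)
      (Num.sqrt ((deg (nth u (u :: s) j))%:R * (deg (nth u (u :: s) j.+1))%:R))^-1.

End Graph.

(* Main.v *)
Require Import Defs.
From HB Require Import structures.
From mathcomp Require Import all_boot all_order all_algebra.
From mathcomp Require Import all_classical all_reals all_analysis.
From mathcomp Require Import complex spectral sesquilinear.
From mathcomp Require Import ring lra zify.
Set Implicit Arguments. Unset Strict Implicit. Unset Printing Implicit Defensive.
Import Order.TTheory GRing.Theory Num.Theory numFieldNormedType.Exports.
Local Open Scope classical_set_scope.
Local Open Scope ring_scope.

(** Write [A] for the normalized adjacency matrix, [W] for the projection on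
    the wells [S = {x, y, z}] and [H = 1 - A - Q W].  For a vector [s]
    supported on [S], the vector [w = \sum_(k <= a) q^-k ((1 - W) A)^k s]
    satisfies [H w = (1 - q) w + (q - Q) s - \sum_k q^-k W A ((1 - W) A)^k s]
    up to [O(q^-a)], and the [k]-th coefficient counts walks of length [k + 1]
    avoiding [S] inside.  By cospectrality these coefficients are scalar on
    [S] for [k < a - 1], and at [k = a - 1] they are a scalar plus the matrix
    [M] with entries [p = c_xy] at [(x, y)], [p' = c_xz] at [(x, z)] ([0] if
    [a < b]) and [0] at [(y, z)].  Choosing [q] so that the scalars cancel
    [q - Q], each eigenvector of [M] with eigenvalue [theta] yields a
    quasimode of energy [1 - q - theta q^(1 - a)] and residual [O(q^-a)].
    Since [M] has the simple spectrum [r, -r, 0], [r^2 = p^2 + p'^2], the gaps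
    dominate the residual: Cauchy-Schwarz in an eigenframe of [H] bounds the
    amplitude for all times, and Duhamel's estimate describes it on the scale
    [t = tau q^(a - 1)], where up to a phase it is [(p / r) sin (r tau)] from [x]
    to [y] and [(p p' / r^2) (cos (r tau) - 1)] from [y] to [z]. *)

(** * Spectral representation of the amplitudes *)

Section RealFrame.
Local Open Scope sesquilinear_scope.

(** Over the complex numbers [H] is Hermitian, hence unitarily diagonalizable with real eigenvalues.
    The real and imaginary parts of each eigenvector are again eigenvectors for the same eigenvalue.
    Stacking them gives a Parseval frame of eigenvectors, not a basis; Parseval's identity is all
    that the later estimates use. *)
Lemma symmetric_real_frame (R : realType) n (H : 'M[R]_n) : H^T = H ->
  exists m (X : 'M[R]_(m, n)) (d : 'rV[R]_m),
    X^T *m X = 1%:M /\ X *m H = diag_mx d *m X.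
Proof.
move=> Hsym; pose A : 'M[R[i]]_n := map_mx (real_complex R) H.
have Aherm : A \is hermsymmx.
  apply/is_hermitianmxP; rewrite expr0 scale1r; apply/matrixP => i j.
  rewrite !mxE -[in LHS]Hsym mxE.
  by apply/eqP; rewrite eq_complex /= eqxx oppr0 eqxx.
have /orthomx_spectralP AE := hermitian_normalmx Aherm.
have dreal := hermitian_spectral_diag_real Aherm.
set P := spectralmx A in AE; set D := spectral_diag A in AE dreal.
have Pu : P \is unitarymx := spectral_unitarymx A.
have Punit := unitarymx_unit Pu.
have PA : P *m A = diag_mx D *m P by rewrite {1}AE !mulmxA mulmxV // mul1mx.
have PP : P^t* *m P = 1%:M by rewrite -(invmx_unitary Pu) mulVmx.
pose d : 'rV[R]_n := map_mx (@complex.Re R) D.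
have DE j : D 0 j = (d 0 j)%:C%C.
  by rewrite mxE RRe_real //; move/mxOverP: dreal; apply.
pose X := map_mx (@complex.Re R) P; pose Y := map_mx (@complex.Im R) P.
have ReS (I : finType) (F : I -> R[i]) :
    complex.Re (\sum_i F i) = \sum_i complex.Re (F i).
  by apply: (big_morph (@complex.Re R)) => // -[? ?] [? ?].
have ImS (I : finType) (F : I -> R[i]) :
    complex.Im (\sum_i F i) = \sum_i complex.Im (F i).
  by apply: (big_morph (@complex.Im R)) => // -[? ?] [? ?].
have XH : X *m H = diag_mx d *m X.
  apply/matrixP => i j; rewrite mul_diag_mx [RHS]mxE [LHS]mxE.
  have /matrixP/(_ i j) := PA; rewrite mul_diag_mx [RHS]mxE [LHS]mxE DE.
  move/(congr1 (@complex.Re R)); rewrite ReS => E.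
  transitivity (complex.Re ((d 0 i)%:C%C * P i j)).
    rewrite -E; apply: eq_bigr => k _; rewrite !mxE.
    by case: (P i k) => ? ? /=; rewrite mulr0 subr0.
  by rewrite [X in _ = _ * X]mxE; case: (P i j) => ? ? /=; rewrite mul0r subr0.
have YH : Y *m H = diag_mx d *m Y.
  apply/matrixP => i j; rewrite mul_diag_mx [RHS]mxE [LHS]mxE.
  have /matrixP/(_ i j) := PA; rewrite mul_diag_mx [RHS]mxE [LHS]mxE DE.
  move/(congr1 (@complex.Im R)); rewrite ImS => E.
  transitivity (complex.Im ((d 0 i)%:C%C * P i j)).
    rewrite -E; apply: eq_bigr => k _; rewrite !mxE.
    by case: (P i k) => ? ? /=; rewrite mulr0 add0r.
  by rewrite [X in _ = _ * X]mxE; case: (P i j) => ? ? /=; rewrite mul0r addr0.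
exists (n + n)%N, (col_mx X Y), (row_mx d d); split.
  rewrite tr_col_mx mul_row_col; apply/matrixP => i j.
  (* The real part of [P^* P = 1] reads [X^T X + Y^T Y = 1], which is the frame identity for the
     stacked rows. *)
  have /matrixP/(_ i j) := PP => /(congr1 (@complex.Re R)).
  rewrite !mxE ReS; set rhs := complex.Re _ => E.
  have -> : (i == j)%:R = rhs :> R by rewrite /rhs; case: (i == j).
  rewrite -E -big_split; apply: eq_bigr => k _; rewrite /= !mxE.
  by case: (P k i) => ? ?; case: (P k j) => ? ? /=; rewrite mulNr opprK.
by rewrite diag_mx_row mul_block_col !mul0mx addr0 add0r mul_col_mx XH YH.
Qed.

End RealFrame.

Lemma frame_expr (R : realType) m n (H : 'M[R]_n) (X : 'M[R]_(m, n))
    (d : 'rV[R]_m) k :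
  X^T *m X = 1%:M -> X *m H = diag_mx d *m X ->
  forall u v, (H ^+ k) v u = \sum_j d 0 j ^+ k * (X j v * X j u).
Proof.
move=> XX XH; have XHk : X *m (H ^+ k) = \matrix_(j, v) (d 0 j ^+ k * X j v).
  elim: k => [|k IH].
    rewrite expr0 mulmx1; apply/matrixP => i j.
    by rewrite mxE expr0 mul1r.
  rewrite exprS -mulmxE mulmxA XH -mulmxA IH mul_diag_mx.
  by apply/matrixP => i j; rewrite !mxE exprS mulrA.
move=> u v; rewrite -[H ^+ k]mul1mx -XX -mulmxA XHk mxE.
by apply: eq_bigr => j _; rewrite !mxE mulrCA.
Qed.

(** The frame formula for [H ^+ k] turns each partial sum into a finite combination of partial sums
    of cosine series, so the limit can be taken term by term. *)
Lemma amp_re_frame (R : realType) m n (H : 'M[R]_n) (X : 'M[R]_(m, n))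
    (d : 'rV[R]_m) :
  X^T *m X = 1%:M -> X *m H = diag_mx d *m X ->
  forall u v t, amp_re H u v t = \sum_j cos (d 0 j * t) * (X j v * X j u).
Proof.
move=> XX XH u v t; apply: cvg_lim => //.
have -> : (fun N => \sum_(k < N) (-1) ^+ k * t ^+ k.*2 / k.*2`!%:R *
      (H ^+ k.*2) v u) =
    (fun N => \sum_j series (cos_coeff' (d 0 j * t)) N * (X j v * X j u)).
  apply/funext => N; under [RHS]eq_bigr do rewrite /series /= big_mkord mulr_suml.
  rewrite exchange_big /=; apply: eq_bigr => k _.
  rewrite (frame_expr _ XX XH) mulr_sumr; apply: eq_bigr => j _.
  by rewrite /cos_coeff' exprMn exprnP; ring.
apply: cvg_big => [|j _]; first exact: add_continuous.
by apply: cvgM; [exact: cvg_cos_coeff'|exact: cvg_cst].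
Qed.

Lemma amp_im_frame (R : realType) m n (H : 'M[R]_n) (X : 'M[R]_(m, n))
    (d : 'rV[R]_m) :
  X^T *m X = 1%:M -> X *m H = diag_mx d *m X ->
  forall u v t, amp_im H u v t = \sum_j sin (d 0 j * t) * (X j v * X j u).
Proof.
move=> XX XH u v t; apply: cvg_lim => //.
have -> : (fun N => \sum_(k < N) (-1) ^+ k * t ^+ k.*2.+1 / k.*2.+1`!%:R *
      (H ^+ k.*2.+1) v u) =
    (fun N => \sum_j series (sin_coeff' (d 0 j * t)) N * (X j v * X j u)).
  apply/funext => N; under [RHS]eq_bigr do rewrite /series /= big_mkord mulr_suml.
  rewrite exchange_big /=; apply: eq_bigr => k _.
  rewrite (frame_expr _ XX XH) mulr_sumr; apply: eq_bigr => j _.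
  by rewrite /sin_coeff' exprMn exprnP; ring.
apply: cvg_big => [|j _]; first exact: add_continuous.
by apply: cvgM; [exact: cvg_sin_coeff'|exact: cvg_cst].
Qed.

(** * Quasimodes *)

Lemma ler_dist_cos (R : realType) (s t : R) : `|cos s - cos t| <= `|s - t|.
Proof.
wlog le_ts : s t / t <= s => [H|].
  by case: (leP t s) => [/H//|/ltW/H]; rewrite distrC [leRHS]distrC.
have cont : {within `[t, s], continuous (@cos R)}.
  by apply: continuous_subspaceT; exact: continuous_cos.
have drv (x : R) : x \in `]t, s[%R -> is_derive x 1 cos (- sin x).
  by move=> _; exact: is_derive_cos.
have [c _ ->] := MVT_segment le_ts drv cont.
by rewrite normrM normrN ler_piMl // sin_max.
Qed.

Lemma ler_dist_sin (R : realType) (s t : R) : `|sin s - sin t| <= `|s - t|.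
Proof.
rewrite -!cosBpihalf; apply: le_trans (ler_dist_cos _ _) _.
by rewrite opprB addrA subrK.
Qed.

(** Cauchy-Schwarz by Lagrange's identity: the double sum of the squares
    [(f i * g j - f j * g i) ^+ 2] is twice the difference of the two sides. *)
Lemma sum_mul_sqr_le (R : realType) (I : finType) (f g : I -> R) :
  (\sum_i f i * g i) ^+ 2 <= (\sum_i f i ^+ 2) * (\sum_i g i ^+ 2).
Proof.
have H : 0 <= \sum_i \sum_j (f i * g j - f j * g i) ^+ 2.
  by apply: sumr_ge0 => i _; apply: sumr_ge0 => j _; exact: sqr_ge0.
have E : \sum_i \sum_j (f i * g j - f j * g i) ^+ 2 =
   (\sum_i f i ^+ 2) * (\sum_i g i ^+ 2) + (\sum_i g i ^+ 2) * (\sum_i f i ^+ 2)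
   - 2 * ((\sum_i f i * g i) * (\sum_i f i * g i)).
  rewrite !big_distrlr /= mulr_sumr -big_split -sumrB; apply: eq_bigr => i _ /=.
  rewrite mulr_sumr -big_split -sumrB; apply: eq_bigr => j _ /=; ring.
by move: H; rewrite E expr2; lra.
Qed.

Lemma sum_norm_mul_le (R : realType) (I : finType) (f g : I -> R) a b :
  0 <= a -> 0 <= b -> \sum_i f i ^+ 2 <= a ^+ 2 -> \sum_i g i ^+ 2 <= b ^+ 2 ->
  \sum_i `|f i| * `|g i| <= a * b.
Proof.
move=> a0 b0 fa gb; rewrite -ler_sqr ?nnegrE; first last.
- exact: mulr_ge0.
- by apply: sumr_ge0 => i _; exact: mulr_ge0.
apply: le_trans (sum_mul_sqr_le _ _) _; rewrite exprMn.
have sq0 (h : I -> R) : 0 <= \sum_i h i ^+ 2.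
  by apply: sumr_ge0 => i _; exact: sqr_ge0.
by under eq_bigr do rewrite real_normK ?num_real//;
  under [X in _ * X <= _]eq_bigr do rewrite real_normK ?num_real//; apply: ler_pM.
Qed.

Definition sqnorm (R : realType) n (w : 'cV[R]_n) : R := \sum_v w v 0 ^+ 2.

Lemma sqnorm_delta (R : realType) n (u : 'I_n) :
  sqnorm (delta_mx u 0 : 'cV[R]_n) = 1.
Proof.
rewrite /sqnorm (bigD1 u) //= mxE !eqxx expr1n big1 ?addr0 // => v /negPf vu.
by rewrite mxE vu expr0n.
Qed.

Section Frame.
Variables (R : realType) (m n : nat) (H : 'M[R]_n) (X : 'M[R]_(m, n)).
Variable d : 'rV[R]_m.
Hypotheses (XX : X^T *m X = 1%:M) (XH : X *m H = diag_mx d *m X).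
Local Notation hat w j := ((X *m w) j 0).

Lemma frame_parseval (w w' : 'cV[R]_n) :
  \sum_j hat w j * hat w' j = \sum_v w v 0 * w' v 0.
Proof.
have E (k : nat) (a b : 'cV[R]_k) : \sum_v a v 0 * b v 0 = (a^T *m b) 0 0.
  by rewrite mxE; apply: eq_bigr => i _; rewrite mxE.
by rewrite !E trmx_mul mulmxA -(mulmxA _ X^T) XX mulmx1.
Qed.

Lemma frame_sqnorm (w : 'cV[R]_n) : \sum_j hat w j ^+ 2 = sqnorm w.
Proof. exact: frame_parseval. Qed.

Lemma frame_delta u j : hat (delta_mx u 0 : 'cV[R]_n) j = X j u.
Proof.
rewrite mxE (bigD1 u) //= big1 ?addr0 => [|v /negPf vu].
  by rewrite mxE !eqxx mulr1.
by rewrite mxE vu mulr0.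
Qed.

Lemma frame_residual (w : 'cV[R]_n) mu j :
  hat (H *m w - mu *: w) j = (d 0 j - mu) * hat w j.
Proof.
by rewrite mulmxBr mulmxA XH -mulmxA mul_diag_mx -scalemxAr !mxE mulrBl.
Qed.

(** In the squared modulus, written as a double sum over eigenvectors, time enters only through the
    factors [cos (d i * t - d j * t)]. Bounding these by 1 gives an estimate valid for all times. *)
Lemma prob_le_overlap u v t :
  prob H u v t <= (\sum_j `|X j u| * `|X j v|) ^+ 2.
Proof.
rewrite /prob (amp_re_frame XX XH) (amp_im_frame XX XH) !expr2 !big_distrlr /=.
rewrite -big_split; apply: ler_sum => i _ /=.
rewrite -big_split; apply: ler_sum => j _ /=.
set ci := cos _; set cj := cos _; set si := sin _; set sj := sin _.
have -> : ci * (X i v * X i u) * (cj * (X j v * X j u)) +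
    si * (X i v * X i u) * (sj * (X j v * X j u)) =
    cos (d 0 i * t - d 0 j * t) * (X i v * X i u * (X j v * X j u)).
  by rewrite cosB -/ci -/cj -/si -/sj; ring.
apply: le_trans (ler_norm _) _; rewrite !normrM.
rewrite [X in _ * X](_ : _ = `|X i u| * `|X i v| * (`|X j u| * `|X j v|)); last by ring.
by rewrite ler_piMl ?mulr_ge0 // cos_max.
Qed.

(** Shifting all energies by [mu] multiplies the amplitude by a phase of modulus 1. This will remove
    the large common energy [1 - q] of the wells. *)
Lemma prob_rotate u v t mu :
  prob H u v t = (\sum_j cos ((d 0 j - mu) * t) * (X j v * X j u)) ^+ 2 +
                 (\sum_j sin ((d 0 j - mu) * t) * (X j v * X j u)) ^+ 2.
Proof.
rewrite /prob (amp_re_frame XX XH) (amp_im_frame XX XH).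
set c := \sum_j cos (d 0 j * t) * _; set s := \sum_j sin (d 0 j * t) * _.
have -> : \sum_j cos ((d 0 j - mu) * t) * (X j v * X j u) =
    cos (mu * t) * c + sin (mu * t) * s.
  rewrite /c /s !mulr_sumr -big_split; apply: eq_bigr => j _ /=.
  by rewrite mulrBl cosB; ring.
have -> : \sum_j sin ((d 0 j - mu) * t) * (X j v * X j u) =
    cos (mu * t) * s - sin (mu * t) * c.
  rewrite /c /s !mulr_sumr -sumrB; apply: eq_bigr => j _ /=.
  by rewrite mulrBl sinB; ring.
have E := cos2Dsin2 (mu * t).
transitivity ((cos (mu * t) ^+ 2 + sin (mu * t) ^+ 2) * (c ^+ 2 + s ^+ 2)); last by ring.
by rewrite E mul1r.
Qed.

Variables (I : finType) (w : I -> 'cV[R]_n) (mu : I -> R) (eps : R).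
Hypothesis eps_ge0 : 0 <= eps.
Hypothesis w_residual : forall i, sqnorm (H *m w i - mu i *: w i) <= eps ^+ 2.

(** The products [(d j - mu i) * hat (w i) j] are the frame coefficients of the residual, so
    Cauchy-Schwarz applies. *)
Lemma residual_le i N (g : 'I_m -> R) : 0 <= N -> \sum_j g j ^+ 2 <= N ^+ 2 ->
  \sum_j `|d 0 j - mu i| * `|hat (w i) j| * `|g j| <= eps * N.
Proof.
move=> N0 gN.
under eq_bigr do rewrite -normrM -frame_residual.
by apply: sum_norm_mul_le => //; rewrite frame_sqnorm.
Qed.

Lemma frame_expand (alpha : I -> R) u j :
  X j u = hat (delta_mx u 0 - \sum_i alpha i *: w i) j +
          \sum_i alpha i * hat (w i) j.
Proof.
rewrite mulmxBr mxE [in X in _ + X + _]mxE frame_delta.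
rewrite mulmx_sumr summxE; under eq_bigr do rewrite -scalemxAr mxE.
by rewrite subrK.
Qed.

(** A form of Duhamel's estimate, with [c] standing for cosine or sine. Replacing [d j] by [mu i]
    inside the 1-Lipschitz function [c] costs [|t| * |d j - mu i|], which sums to the residual;
    [eta] pays for the defect in expanding the initial vector. *)
Lemma amplitude_approx (c : R -> R) (alpha : I -> R) eta u v t mu0 :
  (forall s, `|c s| <= 1) -> (forall s s', `|c s - c s'| <= `|s - s'|) ->
  0 <= eta -> sqnorm (delta_mx u 0 - \sum_i alpha i *: w i) <= eta ^+ 2 ->
  `|\sum_j c ((d 0 j - mu0) * t) * (X j v * X j u) -
    \sum_i alpha i * w i v 0 * c ((mu i - mu0) * t)| <=
  eta + `|t| * eps * \sum_i `|alpha i|.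
Proof.
move=> c1 clip eta0 ualpha.
pose rho j := hat (delta_mx u 0 - \sum_i alpha i *: w i) j.
have wv i : w i v 0 = \sum_j hat (w i) j * X j v.
  under eq_bigr do rewrite -(frame_delta v).
  rewrite frame_parseval (bigD1 v) //= big1 ?addr0 => [|k /negPf kv].
    by rewrite mxE !eqxx mulr1.
  by rewrite mxE kv mulr0.
have -> : \sum_j c ((d 0 j - mu0) * t) * (X j v * X j u) -
    \sum_i alpha i * w i v 0 * c ((mu i - mu0) * t) =
  \sum_j c ((d 0 j - mu0) * t) * rho j * X j v +
  \sum_i alpha i * \sum_j (c ((d 0 j - mu0) * t) - c ((mu i - mu0) * t)) *
     (hat (w i) j * X j v).
  under [X in X - _ = _]eq_bigr => j _.
    rewrite (frame_expand alpha u) -/(rho j).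
    rewrite (_ : _ * _ = c ((d 0 j - mu0) * t) * rho j * X j v +
       \sum_i c ((d 0 j - mu0) * t) * X j v * (alpha i * hat (w i) j)); last first.
      by rewrite -mulr_sumr; ring.
    over.
  rewrite big_split /= -addrA; congr (_ + _).
  rewrite exchange_big /= -sumrB; apply: eq_bigr => i _.
  rewrite wv mulr_sumr mulr_sumr mulr_suml -sumrB; apply: eq_bigr => j _.
  by ring.
have X1 : \sum_j X j v ^+ 2 <= 1 ^+ 2.
  by under eq_bigr do rewrite -frame_delta; rewrite frame_sqnorm sqnorm_delta expr1n.
apply: le_trans (ler_normD _ _) _; apply: lerD.
  apply: le_trans (ler_norm_sum _ _ _) _.
  apply: (@le_trans _ _ (\sum_j `|rho j| * `|X j v|)).
    apply: ler_sum => j _; rewrite -mulrA !normrM ler_piMl ?mulr_ge0 //.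
  rewrite -[leRHS]mulr1; apply: sum_norm_mul_le => //.
  by rewrite frame_sqnorm.
apply: le_trans (ler_norm_sum _ _ _) _; rewrite mulr_sumr; apply: ler_sum => i _.
rewrite normrM mulrC; apply: ler_wpM2r => //.
apply: le_trans (ler_norm_sum _ _ _) _.
apply: (@le_trans _ _ (`|t| * \sum_j `|d 0 j - mu i| * `|hat (w i) j| * `|X j v|)).
  rewrite mulr_sumr; apply: ler_sum => j _; rewrite !normrM -[X in `|t| * X]mulrA.
  rewrite [leRHS]mulrA; apply: ler_wpM2r; first exact: mulr_ge0.
  apply: le_trans (clip _ _) _.
  by rewrite -mulrBl normrM mulrC opprB addrA subrK.
by apply: ler_wpM2l => //; rewrite -[leRHS]mulr1; apply: residual_le.
Qed.

(* Off-diagonal pairs: [delta <= |d - mu i| + |d - mu k|] for every [d], so the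
   spectral overlap of two quasimodes is controlled by their residuals. *)
Lemma overlap_le (alpha beta : I -> R) N eta delta u v :
  0 <= N -> 0 <= eta -> 0 < delta ->
  (forall i, sqnorm (w i) <= N ^+ 2) ->
  sqnorm (delta_mx u 0 - \sum_i alpha i *: w i) <= eta ^+ 2 ->
  sqnorm (delta_mx v 0 - \sum_i beta i *: w i) <= eta ^+ 2 ->
  (forall i k, i != k -> delta <= `|mu i - mu k|) ->
  \sum_j `|X j u| * `|X j v| <=
    eta + N * eta * (\sum_i `|alpha i|) + N ^+ 2 * (\sum_i `|alpha i * beta i|)
    + 2 * eps * N / delta * (\sum_i \sum_k `|alpha i| * `|beta k|).
Proof.
move=> N0 eta0 delta0 wN ualpha vbeta gap.
pose ru j := hat (delta_mx u 0 - \sum_i alpha i *: w i) j.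
pose rv j := hat (delta_mx v 0 - \sum_i beta i *: w i) j.
have X1 : \sum_j X j v ^+ 2 <= 1 ^+ 2.
  by under eq_bigr do rewrite -frame_delta; rewrite frame_sqnorm sqnorm_delta expr1n.
have pair i k : \sum_j `|hat (w i) j| * `|hat (w k) j| <=
    (if i == k then N ^+ 2 else 0) + 2 * eps * N / delta.
  have r0 : 0 <= 2 * eps * N / delta.
    by rewrite divr_ge0 ?(ltW delta0) // !mulr_ge0.
  have hN l : \sum_j hat (w l) j ^+ 2 <= N ^+ 2 by rewrite frame_sqnorm.
  case: (eqVneq i k) => [<-|ik].
    rewrite -[leLHS]addr0; apply: lerD => //; rewrite expr2.
    exact: sum_norm_mul_le.
  rewrite add0r ler_pdivlMr // mulr_suml.
  apply: (@le_trans _ _ (\sum_j (`|d 0 j - mu i| * `|hat (w i) j| * `|hat (w k) j|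
     + `|d 0 j - mu k| * `|hat (w k) j| * `|hat (w i) j|))).
    apply: ler_sum => j _.
    have : delta <= `|d 0 j - mu i| + `|d 0 j - mu k|.
      apply: le_trans (gap _ _ ik) _; rewrite [X in _ <= X + _]distrC.
      apply: le_trans (ler_normD _ _); rewrite addrA subrK //.
    move/(ler_wpM2l (mulr_ge0 (normr_ge0 (hat (w i) j)) (normr_ge0 (hat (w k) j)))).
    by move/le_trans; apply; rewrite le_eqVlt; apply/orP; left; apply/eqP; ring.
  rewrite big_split /=.
  have := residual_le i N0 (hN k); have := residual_le k N0 (hN i).
  by move=> h1 h2; apply: le_trans (lerD h2 h1) _; rewrite -mulrA mulr_natl mulr2n.
(* [X j u] is expanded first, and [X j v] only where it multiplies the quasimode part of [u]. The
   three groups of terms are the defect of [u], the defect of [v], and the pairs of quasimodes. *)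
apply: (@le_trans _ _ (\sum_j (`|ru j| * `|X j v| +
    \sum_i `|alpha i| * (`|hat (w i) j| * `|rv j|) +
    \sum_i \sum_k `|alpha i| * `|beta k| * (`|hat (w i) j| * `|hat (w k) j|)))).
  apply: ler_sum => j _.
  have hu : `|X j u| <= `|ru j| + \sum_i `|alpha i| * `|hat (w i) j|.
    rewrite [in leLHS](frame_expand alpha u).
    apply: le_trans (ler_normD _ _) _; rewrite lerD2l.
    apply: le_trans (ler_norm_sum _ _ _) _.
    by apply: ler_sum => i _; rewrite normrM.
  have hv : `|X j v| <= `|rv j| + \sum_k `|beta k| * `|hat (w k) j|.
    rewrite [in leLHS](frame_expand beta v).
    apply: le_trans (ler_normD _ _) _; rewrite lerD2l.
    apply: le_trans (ler_norm_sum _ _ _) _.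
    by apply: ler_sum => i _; rewrite normrM.
  apply: le_trans (ler_wpM2r (normr_ge0 _) hu) _.
  rewrite mulrDl -addrA lerD2l.
  apply: (@le_trans _ _ ((\sum_i `|alpha i| * `|hat (w i) j|) *
     (`|rv j| + \sum_k `|beta k| * `|hat (w k) j|))).
    by apply: ler_wpM2l => //; apply: sumr_ge0 => i _; exact: mulr_ge0.
  rewrite mulrDr !mulr_suml le_eqVlt; apply/orP; left; apply/eqP; congr (_ + _).
    by apply: eq_bigr => i _; rewrite mulrA.
  apply: eq_bigr => i _; rewrite mulr_sumr; apply: eq_bigr => k _; ring.
rewrite !big_split /= -!addrA; apply: lerD.
  rewrite -[leRHS]mulr1; apply: sum_norm_mul_le => //.
  by rewrite frame_sqnorm.
apply: lerD.
  rewrite exchange_big /= mulr_sumr; apply: ler_sum => i _.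
  rewrite -mulr_sumr mulrC; apply: ler_wpM2r => //.
  by apply: sum_norm_mul_le => //; rewrite frame_sqnorm.
rewrite exchange_big /=.
apply: (@le_trans _ _ (\sum_i \sum_k `|alpha i| * `|beta k| *
   ((if i == k then N ^+ 2 else 0) + 2 * eps * N / delta))).
  apply: ler_sum => i _; rewrite exchange_big /=; apply: ler_sum => k _.
  by rewrite -mulr_sumr; apply: ler_wpM2l; [exact: mulr_ge0|].
rewrite !mulr_sumr -big_split; apply: ler_sum => i _ /=.
rewrite mulr_sumr; under eq_bigr do rewrite mulrDr.
rewrite big_split /=; apply: lerD.
  rewrite (bigD1 i) //= eqxx big1 ?addr0 => [|k /negPf ki].
    by rewrite normrM mulrC.
  by rewrite eq_sym ki mulr0.
by apply: ler_sum => k _; rewrite mulrC.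
Qed.

End Frame.

(** * Limits inferior at infinity *)

Lemma limf_einf_pinfty_ge (R : realType) (F : R -> \bar R) (L : R) :
  (forall eps, 0 < eps -> exists M, forall Q, M < Q -> ((L - eps)%:E <= F Q)%E) ->
  (L%:E <= limf_einf F (pinfty_nbhs R))%E.
Proof.
move=> FL; apply/lee_subgt0Pr => eps eps0.
have [M FM] := FL _ eps0; rewrite -EFinB limf_einfE.
apply: le_trans (ereal_sup_ubound _); last first.
  by exists [set Q | M < Q] => //; exists M; split; [exact: num_real|].
by apply: le_ereal_inf_tmp => _ [Q MQ <-]; exact: FM.
Qed.

Lemma limf_einf_pinfty_le (R : realType) (F : R -> \bar R) (L : R) :
  (forall eps, 0 < eps -> exists M, forall Q, M < Q -> (F Q <= (L + eps)%:E)%E) ->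
  (limf_einf F (pinfty_nbhs R) <= L%:E)%E.
Proof.
move=> FL; apply/lee_addgt0Pr => eps eps0.
have [M FM] := FL _ eps0; rewrite -EFinD limf_einfE.
apply: ge_ereal_sup => _ [V [M' [_ VM']] <-].
(* The limit inferior is a supremum of infima over neighbourhoods of infinity. Each neighbourhood
   contains this point beyond both thresholds, and the value there bounds its infimum. *)
pose Q := Num.max M M' + 1.
have MQ : M < Q by rewrite /Q ltr_pwDr // le_max lexx.
have M'Q : M' < Q by rewrite /Q ltr_pwDr // le_max lexx orbT.
apply: le_trans (FM _ MQ); apply: ereal_inf_lbound; exists Q => //.
exact: VM'.
Qed.

Lemma TCgen_eq (R : realType) (p : R -> R -> R) (L : R) :
  (forall eps, 0 < eps -> exists M, forall Q, M < Q ->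
     forall t, 0 <= t -> p Q t <= L + eps) ->
  (forall eps, 0 < eps -> exists M, forall Q, M < Q ->
     exists2 t, 0 <= t & L - eps <= p Q t) ->
  TCgen p = L%:E.
Proof.
move=> pub plb; apply/eqP; rewrite eq_le; apply/andP; split.
  apply: limf_einf_pinfty_le => eps /pub[M pM]; exists M => Q /pM{}pM.
  by apply: ge_ereal_sup => _ [t /= t0 <-]; rewrite lee_fin pM.
apply: limf_einf_pinfty_ge => eps /plb[M pM]; exists M => Q /pM[t t0 pt].
apply: (@le_trans _ _ (p Q t)%:E); first by rewrite lee_fin.
by apply: ereal_sup_ubound; exists t.
Qed.

Lemma TCwithin_gen_eq (R : realType) (p : R -> R -> R) f (L : R) :
  (forall eps, 0 < eps -> exists M, forall Q, M < Q ->
     forall t, 0 <= t -> p Q t <= L + eps) ->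
  (forall eps, 0 < eps -> exists M, forall Q, M < Q ->
     exists2 t, 0 <= t <= f Q & L - eps <= p Q t) ->
  TCwithin_gen p f = L%:E.
Proof.
move=> pub plb; apply/eqP; rewrite eq_le; apply/andP; split.
  apply: limf_einf_pinfty_le => eps /pub[M pM]; exists M => Q /pM{}pM.
  by apply: ge_ereal_sup => _ [t /= /andP[t0 _] <-]; rewrite lee_fin pM.
apply: limf_einf_pinfty_ge => eps /plb[M pM]; exists M => Q /pM[t t0 pt].
apply: (@le_trans _ _ (p Q t)%:E); first by rewrite lee_fin.
by apply: ereal_sup_ubound; exists t.
Qed.

Lemma TCwithin_gen_le (R : realType) (p : R -> R -> R) f (L : R) :
  (forall eps, 0 < eps -> exists M, forall Q, M < Q ->
     forall t, 0 <= t <= f Q -> p Q t <= L + eps) ->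
  (TCwithin_gen p f <= L%:E)%E.
Proof.
move=> pub; apply: limf_einf_pinfty_le => eps /pub[M pM]; exists M => Q /pM{}pM.
by apply: ge_ereal_sup => _ [t /= t0 <-]; rewrite lee_fin pM.
Qed.

(** * Walks and the normalized adjacency matrix *)

(** This is [D^(-1/2) E D^(-1/2)], with [E] the adjacency matrix and [D] the diagonal matrix of
    degrees. *)
Definition adjmx n (e : rel 'I_n) (R : realType) : 'M[R]_n :=
  \matrix_(i, j)
    (if e i j then (Num.sqrt ((deg e i)%:R * (deg e j)%:R))^-1 else 0).

Lemma laplacianE n (e : rel 'I_n) (R : realType) :
  irreflexive e -> laplacian e R = 1%:M - adjmx e R.
Proof.
move=> irr; apply/matrixP => i j; rewrite !mxE.
case: eqVneq => [<-|_]; first by rewrite irr subr0.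
by rewrite mulr0n sub0r; case: (e i j); rewrite ?oppr0.
Qed.

Lemma adjmx_ge0 n (e : rel 'I_n) (R : realType) i j : 0 <= adjmx e R i j.
Proof. by rewrite mxE; case: ifP => // _; rewrite invr_ge0 sqrtr_ge0. Qed.

Lemma trmx_expr (R : realType) n (A : 'M[R]_n) k : (A ^+ k)^T = A^T ^+ k.
Proof.
by elim: k => [|k IH]; [rewrite !expr0 trmx1|rewrite exprSr exprS -!mulmxE trmx_mul IH].
Qed.

Lemma symmetric_expr (R : realType) n (A : 'M[R]_n) k :
  A^T = A -> forall u v, (A ^+ k) u v = (A ^+ k) v u.
Proof. by move=> Asym u v; rewrite -[in LHS]Asym -trmx_expr mxE. Qed.

Lemma adjmx_sym n (e : rel 'I_n) (R : realType) :
  symmetric e -> (adjmx e R)^T = adjmx e R.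
Proof. by move=> esym; apply/matrixP => i j; rewrite !mxE esym mulrC. Qed.

Lemma adjmx_expr n (e : rel 'I_n) (R : realType) l u v :
  (adjmx e R ^+ l) u v =
  \sum_(s : l.-tuple 'I_n | path e u s && (last u s == v))
    \prod_(j < l) (Num.sqrt ((deg e (nth u (u :: s) j))%:R *
                             (deg e (nth u (u :: s) j.+1))%:R))^-1.
Proof.
elim: l u => [|l IH] u.
  rewrite expr0 mxE; under [RHS]eq_bigr do rewrite big_ord0.
  rewrite big_mkcond (big_pred1 [tuple]) => [|s]; last by apply/esym/eqP; exact: tuple0.
  by rewrite /=; case: (u == v).
rewrite exprS -mulmxE mxE.
(* A walk of length [l.+1] is split into its first step and a walk of length [l]. *)
rewrite (reindex (fun p : 'I_n * l.-tuple 'I_n => [tuple of p.1 :: p.2])) /=; last first.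
  exists (fun s : l.+1.-tuple 'I_n => (thead s, [tuple of behead s])) => /= [[w s] _|s _].
    by congr (_, _); apply: val_inj.
  by rewrite [RHS]tuple_eta; apply: val_inj.
under [RHS]eq_bigl do rewrite -andbA.
rewrite -(pair_big_dep (fun w => e u w)
  (fun w (s : l.-tuple 'I_n) => path e w s && (last w s == v))
  (fun w (s : l.-tuple 'I_n) => \prod_(j < l.+1)
    (Num.sqrt ((deg e (nth u (u :: w :: s) j))%:R *
               (deg e (nth u (w :: s) j))%:R))^-1)) /=.
rewrite [RHS]big_mkcond; apply: eq_bigr => w _ /=; rewrite mxE.
case: ifP => [euw|_]; last by rewrite mul0r.
rewrite IH mulr_sumr; apply: eq_bigr => s _.
rewrite big_ord_recl /=; congr (_ * _); apply: eq_bigr => j _.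
have jl : (j < (size s).+1)%N by rewrite size_tuple (leq_trans (ltn_ord j)).
rewrite /= (set_nth_default u) // add0n.
by rewrite (set_nth_default u w) // size_tuple.
Qed.

Lemma cpathE n (e : rel 'I_n) (R : realType) u v :
  cpath e R u v = (adjmx e R ^+ gdist e u v) u v.
Proof. by rewrite adjmx_expr. Qed.

Lemma adjmx_expr_lt_gdist n (e : rel 'I_n) (R : realType) l u v :
  (l < gdist e u v)%N -> (adjmx e R ^+ l) u v = 0.
Proof.
move=> lt; rewrite adjmx_expr big_pred0 // => s; apply: contraTF lt => suv.
(* Lengths are searched only below [n]; the bound ensures that the entry read from [iota 0 n] is [l]
   and not the default. *)
have ln : (l < gdist e u v -> l < n)%N.
  move=> h; apply: leq_trans h _.
  by rewrite -[leqRHS](size_iota 0) /gdist find_size.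
apply/negP => lt; have := before_find 0%N lt.
rewrite nth_iota ?ln // add0n => /negbT/negP; apply.
by apply/existsP; exists s.
Qed.

(** A path without repeated vertices has fewer than [n] edges, so the search in [gdist] succeeds and
    does not fall off the end of the list. *)
Lemma walkb_gdist n (e : rel 'I_n) u v :
  connect e u v -> walkb e (gdist e u v) u v.
Proof.
move=> /connectP[p ep ->]; case/shortenP: ep => q eq uq _ {p}.
have hasw : has (fun l => walkb e l u (last u q)) (iota 0 n).
  apply/hasP; exists (size q).
    rewrite mem_iota add0n; have := card_uniqP uq => /= cq.
    by rewrite -[X in (_ < X)%N]card_ord -cq max_card.
  by apply/existsP; exists (in_tuple q); rewrite eq eqxx.
have := nth_find 0%N hasw; rewrite nth_iota // -[X in (_ < X)%N](size_iota 0 n).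
by rewrite -has_find.
Qed.

Lemma gdist_gt0 n (e : rel 'I_n) u v :
  connect e u v -> u != v -> (0 < gdist e u v)%N.
Proof.
move=> /walkb_gdist; case: (gdist e u v) => // /existsP[s].
by rewrite [s]tuple0 /= => ->.
Qed.

Lemma deg_gt0 n (e : rel 'I_n) (x y v : 'I_n) :
  connected_graph e -> x != y -> (0 < deg e v)%N.
Proof.
move=> conn xy; have [w wv] : exists w, w != v.
  by case: (eqVneq x v) xy => [->|? _]; [exists y; rewrite eq_sym|exists x].
have /connectP[[|w' p] /= ep lw] := conn v w; first by rewrite lw eqxx in wv.
by apply/card_gt0P; exists w'; rewrite inE; case/andP: ep.
Qed.

Lemma cpath_gt0 n (e : rel 'I_n) (R : realType) u v :
  connected_graph e -> u != v -> 0 < cpath e R u v.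
Proof.
move=> conn uv; have /existsP[s suv] := walkb_gdist (conn u v).
have pos (s' : (gdist e u v).-tuple 'I_n) :
    0 < \prod_(j < gdist e u v) (Num.sqrt ((deg e (nth u (u :: s') j))%:R *
                             (deg e (nth u (u :: s') j.+1))%:R))^-1 :> R.
  apply: prodr_gt0 => j _; rewrite invr_gt0 sqrtr_gt0 mulr_gt0 // ltr0n;
  exact: (deg_gt0 _ conn uv).
rewrite /cpath (bigD1 s) //=; apply: ltr_pwDl; first exact: pos.
by apply: sumr_ge0 => s' _; exact/ltW/pos.
Qed.

(** The walk matrix and [adjmx] are conjugate by the diagonal matrix of the square roots of the
    degrees, and such a conjugation keeps the diagonal of every power. Two distinct vertices and
    connectedness make all degrees positive. *)
Lemma PR_adjmx n (e : rel 'I_n) (R : realType) (x y : 'I_n) v k :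
  connected_graph e -> x != y -> PR e R v k = (adjmx e R ^+ k) v v.
Proof.
move=> conn xy.
pose g i : R := Num.sqrt (deg e i)%:R.
have g0 i : g i != 0 by rewrite gt_eqF // sqrtr_gt0 ltr0n (deg_gt0 i conn xy).
suff E i j : (srw e R ^+ k) i j = (adjmx e R ^+ k) i j * g j / g i.
  by rewrite /PR E mulfK.
elim: k i j => [|k IH] i j.
  rewrite !expr0 !mxE; case: eqVneq => [->|_]; rewrite ?mul0r //=.
  by rewrite mul1r divff.
rewrite !exprS -!mulmxE !mxE !mulr_suml; apply: eq_bigr => l _.
rewrite IH !mxE; case: (e i l); last by rewrite !mul0r.
rewrite sqrtrM ?ler0n // -/(g i) -/(g l).
have -> : ((deg e i)%:R : R) = g i ^+ 2 by rewrite sqr_sqrtr ?ler0n.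
by field; rewrite !g0.
Qed.

(** * Walks avoiding the wells *)

(* [A * avoidmx S A ^+ k] sums over the walks of length [k.+1] whose interior
   avoids [S]. *)
Definition avoidmx (R : realType) n (S : seq 'I_n) (A : 'M[R]_n) : 'M[R]_n :=
  (1 - potW R S) * A.

Lemma mul_potW_mul (R : realType) n (S : seq 'I_n) (P N : 'M[R]_n) u v :
  (P * potW R S * N) u v = \sum_(s | s \in S) P u s * N s v.
Proof.
rewrite -!mulmxE mxE [RHS]big_mkcond; apply: eq_bigr => s _.
rewrite mxE (bigD1 s) //= big1 ?addr0 => [|k /negPf ks].
  by rewrite mxE eqxx /=; case: ifP => _; rewrite ?mulr1 ?mulr0 ?mul0r.
by rewrite mxE ks mulr0.
Qed.

Lemma potW_avoidmx (R : realType) n (S : seq 'I_n) (A : 'M[R]_n) :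
  potW R S * avoidmx S A = 0.
Proof.
suff W2 : potW R S * potW R S = potW R S.
  by rewrite /avoidmx mulrA mulrBr mulr1 W2 subrr mul0r.
rewrite -[in LHS](mulr1 (potW R S * _)); apply/matrixP => u v.
rewrite mul_potW_mul mxE.
transitivity (if u \in S then (u == v)%:R else 0 : R).
  rewrite big_mkcond (bigD1 u) //= big1 ?addr0 => [|k /negPf ku].
    by rewrite !mxE eqxx /=; case: (u \in S); rewrite ?mul1r.
  by rewrite !mxE eq_sym ku mul0r if_same.
by case: (u \in S); case: (u == v).
Qed.

(** Walks of length [m.+1] are sorted by their last interior visit to [S]: either there is none, or
    it occurs at time [i.+1] and an avoiding walk of length [m - i] follows. *)
Lemma expr_avoidmx (R : realType) n (S : seq 'I_n) (A : 'M[R]_n) m :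
  A ^+ m.+1 = A * avoidmx S A ^+ m +
    \sum_(i < m) A ^+ i.+1 * potW R S * (A * avoidmx S A ^+ (m.-1 - i)).
Proof.
elim: m => [|m IH]; first by rewrite big_ord0 addr0 expr0 mulr1.
rewrite exprS IH mulrDr big_ord_recl /= addrA; congr (_ + _).
  rewrite subn0 expr1 [avoidmx S A ^+ m.+1]exprS; set Bm := avoidmx S A ^+ m.
  by rewrite /avoidmx mulrBl mul1r mulrBl mulrBr !mulrA subrK.
rewrite mulr_sumr; apply: eq_bigr => i _.
rewrite !mulrA -exprS; congr (_ * _ ^+ _).
by rewrite /bump /= add1n -subn1 -subnDA add1n.
Qed.

Section Avoid.
Variables (R : realType) (n : nat) (S : seq 'I_n) (A : 'M[R]_n).
Hypothesis A_ge0 : forall i j, 0 <= A i j.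
Local Notation B := (avoidmx S A).

Lemma avoidmxE i j : B i j = if i \in S then 0 else A i j.
Proof.
have : (1 * potW R S * A) i j = \sum_(s | s \in S) 1%:M i s * A s j.
  exact: mul_potW_mul.
rewrite mul1r /avoidmx mulrBl mul1r => E; rewrite mxE [in LHS]mxE E.
rewrite big_mkcond (bigD1 i) //= big1 ?addr0 => [|k /negPf ki].
  by rewrite mxE eqxx; case: ifP => _; rewrite ?mul1r ?subrr ?subr0.
by rewrite mxE eq_sym ki mul0r if_same.
Qed.

Lemma mul_avoidmx_bounds k u v : 0 <= (A * B ^+ k) u v <= (A ^+ k.+1) u v.
Proof.
elim: k u v => [|k IH] u v; first by rewrite expr0 mulr1 expr1 A_ge0 lexx.
rewrite exprSr [A ^+ _]exprSr mulrA -!mulmxE !mxE; apply/andP; split.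
  apply: sumr_ge0 => w _; apply: mulr_ge0; first by case/andP: (IH u w).
  by rewrite avoidmxE; case: ifP.
apply: ler_sum => w _; have /andP[lb ub] := IH u w.
rewrite avoidmxE; case: ifP => _; last exact: ler_wpM2r.
by rewrite mulr0 mulr_ge0 // (le_trans lb).
Qed.

Lemma mul_avoidmx_eq0 k u v : (A ^+ k.+1) u v = 0 -> (A * B ^+ k) u v = 0.
Proof.
move=> E; have := mul_avoidmx_bounds k u v; rewrite E => h.
by apply/eqP; rewrite eq_le andbC.
Qed.

Variable a : nat.
Hypothesis S_far : forall u v, u \in S -> v \in S -> u != v ->
  forall l, (l < a)%N -> (A ^+ l) u v = 0.

(** The last interior visit occurs before time [a], when no well other than [u] can have been
    reached, so only visits to [u] itself contribute. *)
Lemma expr_avoidmx_diag k u v : u \in S -> (k < a)%N ->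
  (A ^+ k.+1) u v = (A * B ^+ k) u v +
    \sum_(i < k) (A ^+ i.+1) u u * (A * B ^+ (k.-1 - i)) u v.
Proof.
move=> uS ka; rewrite (expr_avoidmx S) mxE summxE; congr (_ + _).
apply: eq_bigr => i _; rewrite mul_potW_mul (bigD1 u) //= big1 ?addr0 // => s /andP[sS su].
by rewrite S_far ?mul0r // 1?eq_sym // (leq_ltn_trans (ltn_ord i)).
Qed.

(** After a return to [u] fewer than [a] steps remain, too few to reach [v]. Hence walks of length
    at most [a] between distinct wells avoid [S] inside, up to weight zero. *)
Lemma mul_avoidmx_offdiag k u v : u \in S -> v \in S -> u != v -> (k < a)%N ->
  (A * B ^+ k) u v = (A ^+ k.+1) u v.
Proof.
move=> uS vS uv ka; rewrite expr_avoidmx_diag // big1 ?addr0 // => i _.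
rewrite (@mul_avoidmx_eq0 _ u v) ?mulr0 // S_far //.
by have := ltn_ord i; lia.
Qed.

(** The decomposition at [(u, u)] is a renewal equation: the weights of all closed walks determine
    recursively those of the closed walks avoiding [S] inside. Cospectral wells therefore have equal
    self-energies. *)
Lemma mul_avoidmx_diag u v : u \in S -> v \in S ->
  (forall k, (k <= a)%N -> (A ^+ k) u u = (A ^+ k) v v) ->
  forall k, (k < a)%N -> (A * B ^+ k) u u = (A * B ^+ k) v v.
Proof.
move=> uS vS E; elim/ltn_ind => k IH ka.
have := E _ ka; rewrite (expr_avoidmx_diag _ uS ka) (expr_avoidmx_diag _ vS ka).
set s := \sum_(i < k) _; set s' := \sum_(i < k) _.
suff -> : s = s' by move/addIr.
apply: eq_bigr => i _; have ik := ltn_ord i.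
by rewrite E ?IH //; lia.
Qed.

End Avoid.

(** * The l1 norm, used to bound Euclidean norms *)

Definition l1norm (R : realType) n (w : 'cV[R]_n) : R := \sum_v `|w v 0|.

Section L1.
Variables (R : realType) (n : nat).
Implicit Types w : 'cV[R]_n.

Lemma l1norm_ge0 w : 0 <= l1norm w.
Proof. exact: sumr_ge0. Qed.

Lemma l1normD w w' : l1norm (w + w') <= l1norm w + l1norm w'.
Proof.
by rewrite /l1norm -big_split; apply: ler_sum => v _; rewrite mxE ler_normD.
Qed.

Lemma l1normZ c w : l1norm (c *: w) = `|c| * l1norm w.
Proof. by rewrite /l1norm mulr_sumr; apply: eq_bigr => v _; rewrite mxE normrM. Qed.

Lemma l1norm_sum (I : finType) (F : I -> 'cV[R]_n) :
  l1norm (\sum_i F i) <= \sum_i l1norm (F i).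
Proof.
apply: (big_ind2 (fun w c => l1norm w <= c)) => //.
  by rewrite /l1norm big1 // => v _; rewrite mxE normr0.
by move=> w c w' c' h h'; apply: le_trans (l1normD _ _) (lerD h h').
Qed.

Lemma sqnorm_le w c : l1norm w <= c -> sqnorm w <= c ^+ 2.
Proof.
move=> wc; apply: (@le_trans _ _ (l1norm w ^+ 2)); last first.
  by rewrite ler_sqr ?nnegrE ?l1norm_ge0 // (le_trans _ wc) ?l1norm_ge0.
rewrite /sqnorm /l1norm expr2 mulr_suml; apply: ler_sum => v _.
rewrite -real_normK ?num_real // expr2; apply: ler_wpM2l => //.
by rewrite (bigD1 v) //= lerDl sumr_ge0.
Qed.

Lemma sqnormD_le w r c : sqnorm w = 1 -> l1norm r <= c ->
  sqnorm (w + r) <= (1 + c) ^+ 2.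
Proof.
move=> w1 rc.
have -> : sqnorm (w + r) = sqnorm w + (2 * (\sum_v w v 0 * r v 0) + sqnorm r).
  rewrite /sqnorm mulr_sumr -!big_split; apply: eq_bigr => v _ /=.
  by rewrite mxE; ring.
have := sqnorm_le rc; suff : \sum_v w v 0 * r v 0 <= c by rewrite w1; lra.
apply: le_trans rc; apply: ler_sum => v _; apply: le_trans (ler_norm _) _.
rewrite normrM ler_piMl // -(@ler_pXn2r _ 2) ?nnegrE // expr1n -w1.
by rewrite real_normK ?num_real // /sqnorm (bigD1 v) //= lerDl sumr_ge0 // => *; exact: sqr_ge0.
Qed.

End L1.

(** * Construction of the quasimodes *)

Lemma trmx_potW (R : realType) n (S : seq 'I_n) : (potW R S)^T = potW R S.
Proof.
by apply/matrixP => i j; rewrite !mxE eq_sym; case: eqVneq => // ->.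
Qed.

Lemma potW_mulE (R : realType) n (S : seq 'I_n) (w : 'cV[R]_n) v :
  (potW R S *m w) v 0 = if v \in S then w v 0 else 0.
Proof.
rewrite mxE (bigD1 v) //= big1 ?addr0 => [|k /negPf kv].
  by rewrite mxE eqxx /=; case: ifP; rewrite ?mul1r ?mul0r.
by rewrite mxE eq_sym kv mul0r.
Qed.

Section Quasimode.
Variables (R : realType) (n : nat) (S : seq 'I_n) (A : 'M[R]_n) (a : nat).
Hypothesis a_gt0 : (0 < a)%N.
Local Notation W := (potW R S).
Local Notation B := (avoidmx S A).
Local Notation Hq Q := (1%:M - A - Q *: W).

(** The Neumann series of [(1 - h B)^-1 s], truncated after order [a]. For [s] supported on [S], all
    terms with [k > 0] live off the wells. *)
Definition quasimode (h : R) (s : 'cV[R]_n) : 'cV[R]_n :=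
  \sum_(k < a.+1) h ^+ k *: (B ^+ k *m s).

(** The correction to [s] divided by [h]; in this form it stays bounded for [h] in the unit
    interval. *)
Definition quasitail (h : R) (s : 'cV[R]_n) : 'cV[R]_n :=
  \sum_(k < a) h ^+ k *: (B ^+ k.+1 *m s).

Lemma quasimodeE h s : quasimode h s = s + h *: quasitail h s.
Proof.
rewrite /quasimode big_ord_recl expr0 scale1r expr0 mul1mx scaler_sumr.
by congr (_ + _); apply: eq_bigr => k _; rewrite scalerA -exprS.
Qed.

Lemma potW_quasimode h s : W *m s = s -> W *m quasimode h s = s.
Proof.
move=> Ws; rewrite quasimodeE mulmxDr Ws -scalemxAr mulmx_sumr big1 ?scaler0 ?addr0 //.
move=> k _; rewrite -scalemxAr mulmxA mulmxE exprS mulrA potW_avoidmx.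
by rewrite mul0r mul0mx scaler0.
Qed.

Lemma l1norm_quasitail h s : 0 <= h <= 1 ->
  l1norm (quasitail h s) <= \sum_(k < a) l1norm (B ^+ k.+1 *m s).
Proof.
move=> /andP[h0 h1]; apply: le_trans (l1norm_sum _) _; apply: ler_sum => k _.
rewrite l1normZ ler_piMl ?l1norm_ge0 // normrX ger0_norm //.
exact: exprn_ile1.
Qed.

Lemma avoidmx_step k (s : 'cV[R]_n) :
  A *m (B ^+ k *m s) = W *m ((A * B ^+ k) *m s) + B ^+ k.+1 *m s.
Proof.
have -> : B ^+ k.+1 = A * B ^+ k - W * (A * B ^+ k).
  by rewrite exprS {1}/avoidmx mulrBl mul1r mulrBl -mulrA.
rewrite mulmxBl (_ : (W * (A * B ^+ k)) *m s = W *m ((A * B ^+ k) *m s)).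
  by rewrite addrC subrK mulmxA.
exact: esym (mulmxA _ _ _).
Qed.

Variables (tau : nat -> R) (theta : R) (s : 'cV[R]_n).
Hypothesis Ws : W *m s = s.
Hypothesis s_eigen : forall k, (k < a)%N ->
  W *m ((A * B ^+ k) *m s) = (tau k + (k == a.-1)%:R * theta) *: s.

(** Applying [A] to one term of the series produces its well part and [q] times the next term, so
    everything telescopes up to the truncated end [(A * B ^+ a) *m s]. The well parts are scalars
    absorbed by [q - Q], plus [theta] at order [a.-1]. That energy shift matches on [s] but also
    acts on the tail, whence [theta *: quasitail]. *)
Lemma quasimode_residual (Q q : R) : q != 0 ->
  q - Q = \sum_(k < a) tau k * q^-1 ^+ k ->
  Hq Q *m quasimode q^-1 s - (1 - q - theta * q^-1 ^+ a.-1) *: quasimode q^-1 s =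
  q^-1 ^+ a *: (theta *: quasitail q^-1 s - (A * B ^+ a) *m s).
Proof.
move=> q0 qQ; set h := q^-1; set w := quasimode h s.
have ha : h ^+ a = h ^+ a.-1 * h by rewrite -exprSr prednK.
have Aw : A *m w = (q - Q + h ^+ a.-1 * theta) *: s + q *: (w - s) +
    h ^+ a *: ((A * B ^+ a) *m s).
  rewrite {1}/w /quasimode big_ord_recr /= mulmxDr; congr (_ + _); last first.
    by rewrite -scalemxAr mulmxA mulmxE.
  have -> : q *: (w - s) = quasitail h s.
    by rewrite /w quasimodeE addrC addKr scalerA mulfV // scale1r.
  rewrite mulmx_sumr; under eq_bigr => k _.
    rewrite -scalemxAr avoidmx_step s_eigen // scalerDr scalerA; over.
  rewrite big_split /= -scaler_suml; congr (_ *: _ + _).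
  under eq_bigr do rewrite mulrDr mulrC.
  rewrite big_split /= -qQ; congr (_ + _).
  have a1 : (a.-1 < a)%N by rewrite prednK.
  rewrite (bigD1 (Ordinal a1)) //= eqxx mul1r big1 ?addr0 // => k.
  by rewrite -val_eqE /= => /negPf ->; rewrite mul0r mulr0.
have Ww : W *m w = s := potW_quasimode h Ws.
rewrite !mulmxBl mul1mx -scalemxAl Ww Aw.
have ws : w - s = h *: quasitail h s by rewrite /w quasimodeE addrC addKr.
have -> : h ^+ a *: (theta *: quasitail h s - (A * B ^+ a) *m s) =
    (h ^+ a.-1 * theta) *: (w - s) - h ^+ a *: ((A * B ^+ a) *m s).
  rewrite ws scalerBr !scalerA ha; congr (_ *: _ - _); ring.
set z := (A * B ^+ a) *m s; apply/matrixP => i j; rewrite !mxE; ring.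
Qed.

Lemma quasimode_residual_le (Q q : R) : 1 <= q ->
  q - Q = \sum_(k < a) tau k * q^-1 ^+ k ->
  l1norm (Hq Q *m quasimode q^-1 s -
          (1 - q - theta * q^-1 ^+ a.-1) *: quasimode q^-1 s) <=
  (`|theta| * (\sum_(k < a) l1norm (B ^+ k.+1 *m s)) +
    l1norm ((A * B ^+ a) *m s)) * q^-1 ^+ a.
Proof.
move=> q1 qQ; have q0 : 0 < q := lt_le_trans ltr01 q1.
rewrite quasimode_residual ?gt_eqF // l1normZ ger0_norm; last first.
  by rewrite exprn_ge0 // invr_ge0 ltW.
rewrite mulrC; apply: ler_wpM2r; first by rewrite exprn_ge0 // invr_ge0 ltW.
apply: le_trans (l1normD _ _) _; rewrite -scaleN1r !l1normZ normrN1 mul1r lerD2r.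
apply: ler_wpM2l => //; apply: l1norm_quasitail; rewrite invr_ge0 (ltW q0) /=.
by rewrite invf_le1.
Qed.

End Quasimode.

Section QuasimodeBasis.
Variables (R : realType) (n : nat) (S : seq 'I_n) (A : 'M[R]_n) (a : nat).
Hypotheses (a_gt0 : (0 < a)%N) (A_sym : A^T = A).
Local Notation W := (potW R S).
Local Notation B := (avoidmx S A).
Local Notation Hq Q := (1%:M - A - Q *: W).
Variables (tau : nat -> R) (I : finType) (theta : I -> R) (s : I -> 'cV[R]_n).
Hypothesis Ws : forall i, W *m s i = s i.
Hypothesis s_unit : forall i, sqnorm (s i) = 1.
Hypothesis s_eigen : forall i k, (k < a)%N ->
  W *m ((A * B ^+ k) *m s i) = (tau k + (k == a.-1)%:R * theta i) *: s i.
Variable gam : R.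
Hypothesis gam_gt0 : 0 < gam.
Hypothesis theta_gap : forall i k, i != k -> gam <= `|theta i - theta k|.
Variables u v : 'I_n.
Hypothesis vS : v \in S.
Hypothesis u_expand : delta_mx u 0 = \sum_i s i u 0 *: s i.
Hypothesis v_expand : delta_mx v 0 = \sum_i s i v 0 *: s i.

Let T (w : 'cV[R]_n) := \sum_(k < a) l1norm (B ^+ k.+1 *m w).
Let T_ge0 w : 0 <= T w. Proof. by apply: sumr_ge0 => k _; exact: l1norm_ge0. Qed.

(** The leading terms of the quasimodes recombine to the indicator vector, and [quasitail] is
    linear, so the defect is of order [h]. *)
Lemma quasimode_expand h x : delta_mx x 0 = \sum_i s i x 0 *: s i ->
  delta_mx x 0 - \sum_i s i x 0 *: quasimode S A a h (s i) =
  - (h *: quasitail S A a h (delta_mx x 0)).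
Proof.
move=> xE; rewrite {2}xE.
have -> : quasitail S A a h (\sum_i s i x 0 *: s i) = \sum_i s i x 0 *: quasitail S A a h (s i).
  rewrite /quasitail; under [RHS]eq_bigr do rewrite scaler_sumr.
  rewrite exchange_big; apply: eq_bigr => k _ /=.
  rewrite mulmx_sumr scaler_sumr; apply: eq_bigr => i _.
  by rewrite -scalemxAr !scalerA mulrC.
rewrite xE -sumrB scaler_sumr -sumrN; apply: eq_bigr => i _.
by rewrite quasimodeE scalerDr opprD addrA subrr sub0r !scalerA mulrC.
Qed.

Lemma quasimode_prob : exists2 C : R, 0 <= C & forall Q q : R, 1 <= q ->
  q - Q = \sum_(k < a) tau k * q^-1 ^+ k ->
  (forall t, prob (Hq Q) u v t <= (\sum_i `|s i u 0 * s i v 0| + C / q) ^+ 2) /\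
  (forall t, exists re im : R, [/\ prob (Hq Q) u v t = re ^+ 2 + im ^+ 2,
     `|re - \sum_i s i u 0 * s i v 0 * cos (theta i * (t * q^-1 ^+ a.-1))| <=
       C / q * (1 + `|t| * q^-1 ^+ a.-1) &
     `|im - \sum_i s i u 0 * s i v 0 * sin (theta i * (t * q^-1 ^+ a.-1))| <=
       C / q * (1 + `|t| * q^-1 ^+ a.-1)]).
Proof.
pose C1 := \sum_i (`|theta i| * T (s i) + l1norm ((A * B ^+ a) *m s i)).
pose C2 := T (delta_mx u 0) + T (delta_mx v 0) + \sum_i T (s i).
pose Sa := \sum_i `|s i u 0|.
pose Sab := \sum_i \sum_k `|s i u 0| * `|s k v 0|.
pose A0 := \sum_i `|s i u 0 * s i v 0|.
have C1_ge0 : 0 <= C1.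
  by apply: sumr_ge0 => i _; rewrite addr_ge0 ?l1norm_ge0 // mulr_ge0.
have sT_ge0 : 0 <= \sum_i T (s i) by apply: sumr_ge0.
have C2_ge0 : 0 <= C2 by rewrite !addr_ge0.
have Sa_ge0 : 0 <= Sa by apply: sumr_ge0.
have A0_ge0 : 0 <= A0 by apply: sumr_ge0.
have Sab_ge0 : 0 <= Sab.
  by apply: sumr_ge0 => i _; apply: sumr_ge0 => k _; exact: mulr_ge0.
(* The coefficients of [h] in the overlap bound, once every [h ^+ 2] is replaced by [h]. *)
pose CU := C2 + (1 + C2) * C2 * Sa + (2 * C2 + C2 ^+ 2) * A0
           + 2 * (C1 / gam) * (1 + C2) * Sab.
have CU_ge0 : 0 <= CU.
  by rewrite !addr_ge0 // ?mulr_ge0 ?addr_ge0 ?mulr_ge0 ?invr_ge0 ?(ltW gam_gt0).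
have Ctot_ge0 : 0 <= CU + C2 + C1 * Sa.
  by apply: addr_ge0; [exact: addr_ge0|exact: mulr_ge0].
exists (CU + C2 + C1 * Sa) => //.
move=> Q q q1 qQ; set h := q^-1; set H := Hq Q.
have q0 : 0 < q := lt_le_trans ltr01 q1.
have h0 : 0 < h by rewrite invr_gt0.
have h1 : h <= 1 by rewrite /h invf_le1.
have h01 : 0 <= h <= 1 by rewrite (ltW h0).
have Hsym : H^T = H.
  by rewrite /H !(raddfB, trmx1) /= trmx1 A_sym linearZ /= trmx_potW.
have [m [X [d [XX XH]]]] := symmetric_real_frame Hsym.
pose w i := quasimode S A a h (s i).
pose mu i := 1 - q - theta i * h ^+ a.-1.
have ha : h ^+ a = h ^+ a.-1 * h by rewrite -exprSr prednK.
have hp : 0 < h ^+ a.-1 by rewrite exprn_gt0.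
have eps_ge0 : 0 <= C1 * h ^+ a by rewrite mulr_ge0 // exprn_ge0 // ltW.
have res i : sqnorm (H *m w i - mu i *: w i) <= (C1 * h ^+ a) ^+ 2.
  apply: sqnorm_le; apply: le_trans.
    exact: (quasimode_residual_le a_gt0 (Ws i) (s_eigen i) q1 qQ).
  apply: ler_wpM2r; first by rewrite exprn_ge0 // ltW.
  rewrite /C1 [leRHS](bigD1 i) //= lerDl; apply: sumr_ge0 => k _.
  by rewrite addr_ge0 ?l1norm_ge0 // mulr_ge0.
have eta_ge0 : 0 <= C2 * h by rewrite mulr_ge0 // ltW.
have expand x : delta_mx x 0 = \sum_i s i x 0 *: s i -> T (delta_mx x 0) <= C2 ->
    sqnorm (delta_mx x 0 - \sum_i s i x 0 *: w i) <= (C2 * h) ^+ 2.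
  move=> xE xC; apply: sqnorm_le; rewrite (quasimode_expand h xE) -scaleN1r.
  rewrite !l1normZ normrN1 mul1r gtr0_norm // mulrC; apply: ler_wpM2r; first exact: ltW.
  by apply: le_trans xC; exact: l1norm_quasitail.
have uC := expand u u_expand _; have vC := expand v v_expand _.
have {}uC := uC ltac:(rewrite /C2 -addrA lerDl addr_ge0 //).
have {}vC := vC ltac:(rewrite /C2 -addrA addrCA lerDl addr_ge0 //).
have wN i : sqnorm (w i) <= (1 + C2 * h) ^+ 2.
  rewrite /w quasimodeE; apply: sqnormD_le => //.
  rewrite l1normZ gtr0_norm // mulrC; apply: ler_wpM2r; first exact: ltW.
  apply: le_trans (l1norm_quasitail S A a (s i) h01) _.
  rewrite /C2 (bigD1 i) //= addrCA lerDl !addr_ge0 //; exact: sumr_ge0.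
have N_ge0 : 0 <= 1 + C2 * h by rewrite addr_ge0.
(* The gaps are of order [h ^+ a.-1] and the residuals of order [h ^+ a], so their quotient in the
   overlap bound is of order [h]. *)
have gap i k : i != k -> gam * h ^+ a.-1 <= `|mu i - mu k|.
  move=> /theta_gap ik; rewrite distrC.
  rewrite (_ : mu k - mu i = (theta i - theta k) * h ^+ a.-1); last by rewrite /mu; ring.
  by rewrite normrM (gtr0_norm hp) ler_wpM2r // ltW.
have wv i : w i v 0 = s i v 0.
  by have := potW_mulE S (w i) v; rewrite vS potW_quasimode.
split=> t.
  apply: le_trans (prob_le_overlap XX XH _ _ _) _.
  rewrite ler_sqr ?nnegrE; first last.
  - by apply: addr_ge0 => //; apply: divr_ge0 => //; exact: ltW.
  - by apply: sumr_ge0 => j _; exact: mulr_ge0.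
  have delta_gt0 : 0 < gam * h ^+ a.-1 by exact: mulr_gt0.
  have := @overlap_le _ _ _ _ _ _ XX XH _ _ _ _ eps_ge0 res _ _ _ _ _ u v
    N_ge0 eta_ge0 delta_gt0 wN uC vC gap.
  rewrite -/Sa -/A0 -/Sab => /le_trans; apply.
  have -> : 2 * (C1 * h ^+ a) * (1 + C2 * h) / (gam * h ^+ a.-1) =
     2 * (C1 / gam) * (1 + C2 * h) * h.
    by rewrite ha; field; rewrite !gt_eqF.
  rewrite -/h.
  have hh : h ^+ 2 <= h by rewrite expr2 ler_piMl // ltW.
  have e1 : (1 + C2 * h) * (C2 * h) * Sa <= (1 + C2) * C2 * Sa * h.
    have := mulr_ge0 (mulr_ge0 (mulr_ge0 C2_ge0 C2_ge0) Sa_ge0) (_ : 0 <= h - h ^+ 2).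
    by rewrite subr_ge0 => /(_ hh); lra.
  have e2 : (1 + C2 * h) ^+ 2 * A0 <= A0 + (2 * C2 + C2 ^+ 2) * A0 * h.
    have := mulr_ge0 (mulr_ge0 (mulr_ge0 C2_ge0 C2_ge0) A0_ge0) (_ : 0 <= h - h ^+ 2).
    by rewrite subr_ge0 => /(_ hh); lra.
  have g_ge0 : 0 <= C1 / gam by rewrite divr_ge0 // ltW.
  have e3 : 2 * (C1 / gam) * (1 + C2 * h) * h * Sab <=
      2 * (C1 / gam) * (1 + C2) * Sab * h.
    have := mulr_ge0 (mulr_ge0 (mulr_ge0 g_ge0 C2_ge0) Sab_ge0) (_ : 0 <= h - h ^+ 2).
    by rewrite subr_ge0 => /(_ hh); lra.
  have e4 : 0 <= (C2 + C1 * Sa) * h.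
    by apply: mulr_ge0; [apply: addr_ge0 => //; exact: mulr_ge0|exact: ltW].
  by rewrite /CU; lra.
pose c (g : R -> R) := \sum_j g ((d 0 j - (1 - q)) * t) * (X j v * X j u).
have approx (g : R -> R) : (forall x, `|g x| <= 1) ->
    (forall x y, `|g x - g y| <= `|x - y|) ->
    `|c g - \sum_i s i u 0 * s i v 0 * g (- (theta i * (t * h ^+ a.-1)))| <=
    (CU + C2 + C1 * Sa) / q * (1 + `|t| * h ^+ a.-1).
  move=> g1 glip.
  have := @amplitude_approx _ _ _ _ _ _ XX XH _ _ _ _ eps_ge0 res g
    (fun i => s i u 0) _ u v t (1 - q) g1 glip eta_ge0 uC.
  under [X in `|_ - X| <= _ -> _]eq_bigr => i _.
    rewrite wv (_ : (mu i - (1 - q)) * t = - (theta i * (t * h ^+ a.-1))); last first.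
      by rewrite /mu; ring.
    over.
  move/le_trans; apply; rewrite -/Sa -/h ha.
  have e1 : 0 <= CU * h by rewrite mulr_ge0 // ltW.
  have th0 : 0 <= `|t| * h ^+ a.-1 by rewrite mulr_ge0 // ltW.
  have e2 : 0 <= (CU + C2) * h * (`|t| * h ^+ a.-1).
    by do 2!apply: mulr_ge0 => //; [exact: addr_ge0|exact: ltW].
  have e3 : 0 <= C1 * Sa * h by do 2?apply: mulr_ge0 => //; exact: ltW.
  by lra.
(* The quasimode energies lie at [- theta i * h ^+ a.-1] relative to [1 - q]; the sign of the sine
   part is reversed to match, which its square does not see. *)
exists (c cos), (- c sin); split.
- by rewrite sqrrN; exact: prob_rotate.
- have := approx cos (@cos_max R) (@ler_dist_cos R).
  by under eq_bigr do rewrite cosN.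
- have := approx sin (@sin_max R) (@ler_dist_sin R).
  under eq_bigr do rewrite sinN mulrN.
  by rewrite sumrN opprK -opprD normrN.
Qed.

End QuasimodeBasis.

(** * Tunneling in rescaled time *)

(* Time is measured as [tau = t / scale Q]; [m] is the limiting profile. *)
Definition tunnels_to (R : realType) (p : R -> R -> R) (scale : R -> R) (L : R)
    (m : R -> R) : Prop :=
  (forall eps, 0 < eps -> exists M, forall Q, M < Q ->
     forall t, p Q t <= L + eps) /\
  (forall T eps, 0 < eps -> exists M, forall Q, M < Q ->
     forall tau, 0 <= tau <= T -> `|p Q (tau * scale Q) - m tau| <= eps).

Section TunnelsTo.
Variables (R : realType) (scale : R -> R).

Lemma tunnels_toD (p p' : R -> R -> R) L L' m m' :
  tunnels_to p scale L m -> tunnels_to p' scale L' m' ->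
  tunnels_to (fun Q t => p Q t + p' Q t) scale (L + L') (fun tau => m tau + m' tau).
Proof.
move=> [up tp] [up' tp']; split.
  move=> eps /divr_gt0 - /(_ 2 (ltr0n _ 2)) eps2.
  have [M hM] := up _ eps2; have [M' hM'] := up' _ eps2.
  exists (Num.max M M') => Q; rewrite gt_max => /andP[/hM{}hM /hM'{}hM'] t.
  by have := hM t; have := hM' t; lra.
move=> T eps /divr_gt0 - /(_ 2 (ltr0n _ 2)) eps2.
have [M hM] := tp T _ eps2; have [M' hM'] := tp' T _ eps2.
exists (Num.max M M') => Q; rewrite gt_max => /andP[/hM{}hM /hM'{}hM'] tau tauT.
rewrite opprD addrACA; apply: le_trans (ler_normD _ _) _.
by have := hM _ tauT; have := hM' _ tauT; lra.
Qed.

Variables (p : R -> R -> R) (L : R) (m : R -> R).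
Hypothesis pT : tunnels_to p scale L m.
Variables (K : R) (b : nat).
Hypothesis scale_bounds : forall Q, 1 <= Q -> Q ^+ b <= scale Q <= K * Q ^+ b.
Variable tau0 : R.
Hypotheses (tau0_ge0 : 0 <= tau0) (mL : m tau0 = L).

Let scale_gt0 Q : 1 <= Q -> 0 < scale Q.
Proof.
move=> Q1; have /andP[+ _] := scale_bounds Q1; apply: lt_le_trans.
by rewrite exprn_gt0 // (lt_le_trans ltr01).
Qed.

Let attained eps : 0 < eps -> exists M, forall Q, M < Q ->
  exists2 t, 0 <= t <= tau0 * K * Q ^+ b & L - eps <= p Q t.
Proof.
move=> eps0; have [M hM] := pT.2 tau0 _ eps0.
exists (Num.max M 1) => Q; rewrite gt_max => /andP[/hM{}hM /ltW Q1].
have /andP[_ sK] := scale_bounds Q1.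
exists (tau0 * scale Q).
  by rewrite mulr_ge0 ?(ltW (scale_gt0 Q1)) //= -mulrA ler_wpM2l.
have /hM : 0 <= tau0 <= tau0 by rewrite tau0_ge0 lexx.
by rewrite mL ler_norml => /andP[]; lra.
Qed.

Lemma tunnels_to_TC : TCgen p = L%:E.
Proof.
apply: TCgen_eq => eps eps0.
  by have [M hM] := pT.1 _ eps0; exists M => Q /hM.
have [M hM] := attained eps0; exists M => Q /hM[t /andP[t0 _] ?].
by exists t.
Qed.

(** The upper bound on the time comes from the peak at [tau0]. For the lower bound, a window of size
    [o(Q ^+ b)] shrinks to 0 in rescaled time, where a profile below [K' * tau] vanishes, while [L]
    is positive. *)
Lemma tunnels_to_time K' : 0 < L -> 0 <= K' ->
  (forall tau, 0 <= tau -> m tau <= K' * tau) ->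
  tunnel_time_gen p (fun Q => Q ^+ b).
Proof.
move=> L0 K'0 mK; split.
  exists (fun Q => tau0 * K * Q ^+ b); split.
    by exists `|tau0 * K|, 0 => Q _; rewrite normrM.
  rewrite tunnels_to_TC; apply/esym/TCwithin_gen_eq => [eps eps0|]; last exact: attained.
  by have [M hM] := pT.1 _ eps0; exists M => Q /hM.
move=> f fo; rewrite tunnels_to_TC => E.
suff : (TCwithin_gen p f <= 0%:E)%E by rewrite -E lee_fin leNgt L0.
apply: TCwithin_gen_le => eps eps0.
(* Chosen so that [K' * tau1 <= eps / 2]; the added 1 covers [K' = 0]. *)
pose tau1 := eps / (2 * (K' + 1)).
have K'1 : 0 < 2 * (K' + 1) by rewrite mulr_gt0 // ltr_wpDl.
have tau1_gt0 : 0 < tau1 by exact: divr_gt0.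
have [M hM] := fo _ tau1_gt0.
have eps2 : 0 < eps / 2 by exact: divr_gt0.
have [M' hM'] := pT.2 tau1 _ eps2.
exists (Num.max M (Num.max M' 1)) => Q.
rewrite !gt_max => /and3P[/ltW/hM{}hM /hM'{}hM' /ltW Q1] t /andP[t0 tf].
have sQ := scale_gt0 Q1; have /andP[Qs _] := scale_bounds Q1.
have Qb : 0 <= Q ^+ b by rewrite exprn_ge0 // (le_trans ler01).
have tE : t = t / scale Q * scale Q by rewrite divfK // gt_eqF.
have tau_le : t / scale Q <= tau1.
  rewrite ler_pdivrMr //; apply: le_trans tf _; apply: le_trans (ler_norm _) _.
  apply: le_trans hM _; apply: ler_wpM2l; first exact: ltW.
  by rewrite ger0_norm.
have tau_ge : 0 <= t / scale Q by rewrite divr_ge0 // ltW.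
have /hM' : 0 <= t / scale Q <= tau1 by rewrite tau_ge.
rewrite -tE ler_norml => /andP[_ hp].
have h1 := mK _ tau_ge; have h2 := ler_wpM2l K'0 tau_le.
have h3 : K' * tau1 <= eps / 2.
  rewrite /tau1 mulrA ler_pdivrMr // [leRHS](_ : _ = eps * (K' + 1)); last by field.
  by rewrite mulrC; apply: ler_wpM2l; [exact: ltW|rewrite lerDl].
by lra.
Qed.

End TunnelsTo.

Lemma prob_sym (R : realType) n (H : 'M[R]_n) u v t :
  H^T = H -> prob H u v t = prob H v u t.
Proof.
move=> Hsym; rewrite /prob /amp_re /amp_im.
under eq_fun do under eq_bigr do rewrite (symmetric_expr _ Hsym).
by under [in X in _ + X ^+ 2 = _]eq_fun do
  under eq_bigr do rewrite (symmetric_expr _ Hsym).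
Qed.

(* Solving this equation absorbs the diagonal self-energies of the wells in the
   energy [1 - q]. *)
Lemma renormalized_potential (R : realType) (a : nat) (tau : nat -> R) :
  (forall k, (k < a)%N -> 0 <= tau k) -> forall Q : R, 1 <= Q -> exists q : R,
  Q <= q <= Q + \sum_(k < a) tau k /\ q - Q = \sum_(k < a) tau k * q^-1 ^+ k.
Proof.
move=> tau0 Q Q1; set T := \sum_(k < a) tau k.
have T0 : 0 <= T by apply: sumr_ge0 => k _; exact: tau0.
pose F (q : R) := q - \sum_(k < a) tau k * q^-1 ^+ k.
have sum_ge0 q : 1 <= q -> 0 <= \sum_(k < a) tau k * q^-1 ^+ k.
  move=> q1; apply: sumr_ge0 => k _; rewrite mulr_ge0 ?tau0 // exprn_ge0 //.
  by rewrite invr_ge0 (le_trans ler01).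
have sum_le q : 1 <= q -> \sum_(k < a) tau k * q^-1 ^+ k <= T.
  move=> q1; apply: ler_sum => k _; rewrite ler_piMr ?tau0 // exprn_ile1 //.
    by rewrite invr_ge0 (le_trans ler01).
  by rewrite invf_le1 // (lt_le_trans ltr01).
have QT : Q <= Q + T by rewrite lerDl.
have Fcont : {within `[Q, Q + T], continuous F}.
  apply: continuous_in_subspaceT => q; rewrite inE /= in_itv /= => /andP[Qq _].
  have q0 : q != 0 by rewrite gt_eqF // (lt_le_trans ltr01) // (le_trans Q1).
  apply: cvgB; first exact: cvg_id.
  apply: cvg_big => [|k _]; first exact: add_continuous.
  apply: cvgM; first exact: cvg_cst.
  apply: (@cvg_comp _ _ _ (fun x : R => x^-1) (fun x => x ^+ k)); last exact: exprn_continuous.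
  by apply: cvgV => //; exact: cvg_id.
(* For [q >= 1] the sum lies between 0 and [T], so [F] crosses the value [Q] between [Q] and
   [Q + T]. *)
have [|q] := @IVT R F Q (Q + T) Q QT Fcont.
  have h1 : F Q <= Q by rewrite /F lerBlDr lerDl sum_ge0.
  have h2 : Q <= F (Q + T).
    by rewrite /F -addrA lerDl subr_ge0 sum_le // (le_trans Q1).
  by rewrite ge_min h1 le_max h2 orbT.
rewrite in_itv /= => Qq Fq; exists q; split => //.
by rewrite -{1}Fq /F opprB addrC subrK.
Qed.

(** * Three wells *)

Lemma quasimode_tunnels_to (R : realType) (p : R -> R -> R) (q : R -> R)
    (b : nat) (I : finType) (g theta : I -> R) (C : R) :
  0 <= C -> (forall Q, 1 <= Q -> Q <= q Q) ->
  (forall Q, 1 <= Q ->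
    (forall t, p Q t <= (\sum_i `|g i| + C / q Q) ^+ 2) /\
    (forall t, exists re im : R, [/\ p Q t = re ^+ 2 + im ^+ 2,
       `|re - \sum_i g i * cos (theta i * (t * (q Q)^-1 ^+ b))| <=
         C / q Q * (1 + `|t| * (q Q)^-1 ^+ b) &
       `|im - \sum_i g i * sin (theta i * (t * (q Q)^-1 ^+ b))| <=
         C / q Q * (1 + `|t| * (q Q)^-1 ^+ b)])) ->
  tunnels_to p (fun Q => q Q ^+ b) ((\sum_i `|g i|) ^+ 2)
    (fun tau => (\sum_i g i * cos (theta i * tau)) ^+ 2 +
                (\sum_i g i * sin (theta i * tau)) ^+ 2).
Proof.
move=> C0 qQ; pose A0 : R := \sum_i `|g i|; rewrite -/A0 => pE.
have A0_ge0 : 0 <= A0 by exact: sumr_ge0.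
have small (D eps : R) : 0 <= D -> 0 < eps -> exists M, forall Q, M < Q ->
    1 <= Q /\ D / q Q <= eps.
  move=> D0 eps0; exists (Num.max 1 (D / eps)) => Q.
  rewrite gt_max => /andP[/ltW Q1 DQ]; split => //.
  have qQ0 : 0 < q Q by rewrite (lt_le_trans _ (qQ _ Q1)) // (lt_le_trans ltr01).
  rewrite ler_pdivrMr // mulrC -ler_pdivrMr //.
  exact: le_trans (ltW DQ) (qQ _ Q1).
split.
  (* An error [c <= 1] raises the square of [A0] by [c * (2 * A0 + c) <= c * (2 * A0 + 1)]. The
     second half uses the same choice with a further factor 2, for the real and imaginary parts. *)
  move=> /= eps eps0; pose k := Num.min 1 (eps / (2 * A0 + 1)).
  have A1 : 0 < 2 * A0 + 1 by rewrite ltr_wpDl // mulr_ge0.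
  have k0 : 0 < k by rewrite lt_min ltr01 divr_gt0.
  have [M hM] := small C _ C0 k0; exists M => Q /hM[Q1 Ck] t.
  have [+ _] := pE _ Q1 => /(_ t) /le_trans; apply.
  have Cq0 : 0 <= C / q Q.
    by rewrite divr_ge0 // (le_trans ler01) // (le_trans Q1) // qQ.
  move: Ck; rewrite le_min => /andP[c1]; rewrite ler_pdivlMr // => c2.
  have : C / q Q * (C / q Q) <= C / q Q by rewrite ler_piMl.
  by rewrite sqrrD -[X in X <= _]expr2 -/A0; move: c2; set c := C / q Q; lra.
move=> T eps eps0; pose k := Num.min 1 (eps / (2 * (2 * A0 + 1))).
have A1 : 0 < 2 * (2 * A0 + 1) by rewrite mulr_gt0 // ltr_wpDl // mulr_ge0.
have k0 : 0 < k by rewrite lt_min ltr01 divr_gt0.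
have [M hM] := small (C * (1 + `|T|)) _ (mulr_ge0 C0 (addr_ge0 ler01 (normr_ge0 T))) k0.
exists M => Q /hM[Q1 Ck] tau /andP[tau0 tauT].
have qQ0 : 0 < q Q by rewrite (lt_le_trans ltr01) // (le_trans Q1) // qQ.
have [_ /(_ (tau * q Q ^+ b))] := pE _ Q1.
have tE : tau * q Q ^+ b * (q Q)^-1 ^+ b = tau.
  by rewrite -mulrA -exprMn mulfV ?gt_eqF // expr1n mulr1.
rewrite normrM (ger0_norm tau0) (ger0_norm (exprn_ge0 b (ltW qQ0))) tE.
move=> [re [im [-> hre him]]].
set c := \sum_i g i * cos _ in hre *; set s := \sum_i g i * sin _ in him *.
have kle : C / q Q * (1 + tau) <= k.
  apply: le_trans Ck; rewrite mulrAC; apply: ler_wpM2r; first by rewrite invr_ge0 ltW.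
  apply: ler_wpM2l => //; rewrite lerD2l; apply: le_trans tauT _; exact: ler_norm.
have trig_le (f : R -> R) : (forall x, `|f x| <= 1) ->
    `|\sum_i g i * f (theta i * tau)| <= A0.
  move=> f1; apply: le_trans (ler_norm_sum _ _ _) _; apply: ler_sum => i _.
  by rewrite normrM ler_piMr.
have sqr_close (x y : R) : `|y| <= A0 -> `|x - y| <= C / q Q * (1 + tau) ->
    `|x ^+ 2 - y ^+ 2| <= eps / 2.
  move=> yA xy; have {}xy := le_trans xy kle.
  have -> : x ^+ 2 - y ^+ 2 = (x - y) * (2 * y + (x - y)) by ring.
  have xy1 : `|x - y| <= 1 by apply: le_trans xy _; rewrite ge_min lexx.
  have xy2 : `|x - y| * (2 * (2 * A0 + 1)) <= eps.
    by rewrite -ler_pdivlMr //; apply: le_trans xy _; rewrite ge_min lexx orbT.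
  rewrite normrM; apply: (@le_trans _ _ (`|x - y| * (2 * A0 + 1))).
    apply: ler_wpM2l => //; apply: le_trans (ler_normD _ _) _.
    by rewrite normrM ger0_norm //; lra.
  by move: xy2; set w := `|x - y|; lra.
have h1 := sqr_close _ _ (trig_le cos (@cos_max R)) hre.
have h2 := sqr_close _ _ (trig_le sin (@sin_max R)) him.
rewrite opprD addrACA; apply: le_trans (ler_normD _ _) _.
by move: h1 h2; rewrite -/c -/s; lra.
Qed.

Section ThreeWells.
Variables (R : realType) (n : nat) (x y z : 'I_n).
Hypotheses (xy : x != y) (xz : x != z) (yz : y != z).
Local Notation S := [:: x; y; z].
Local Notation W := (potW R S).

Definition vec3 (a b c : R) : 'cV[R]_n :=
  a *: delta_mx x 0 + b *: delta_mx y 0 + c *: delta_mx z 0.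

Lemma vec3E a b c v : vec3 a b c v 0 =
  if v == x then a else if v == y then b else if v == z then c else 0.
Proof.
rewrite !mxE !eqxx !andbT; case: (eqVneq v x) => [->|_].
  by rewrite (negPf xy) (negPf xz) mulr1 !mulr0 !addr0.
case: (eqVneq v y) => [->|_]; first by rewrite (negPf yz) mulr1 !mulr0 addr0 add0r.
by case: (eqVneq v z) => _; rewrite ?mulr1 !mulr0 !add0r.
Qed.

Lemma vec3x a b c : vec3 a b c x 0 = a.
Proof. by rewrite vec3E eqxx. Qed.

Lemma vec3y a b c : vec3 a b c y 0 = b.
Proof. by rewrite vec3E eq_sym (negPf xy) eqxx. Qed.

Lemma vec3z a b c : vec3 a b c z 0 = c.
Proof. by rewrite vec3E eq_sym (negPf xz) eq_sym (negPf yz) eqxx. Qed.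

Lemma potW_vec3 (w : 'cV[R]_n) : W *m w = vec3 (w x 0) (w y 0) (w z 0).
Proof.
apply/colP => v; rewrite potW_mulE vec3E !inE.
case: (eqVneq v x) => [->|_] //=; case: (eqVneq v y) => [->|_] //=.
by case: (eqVneq v z) => [->|_].
Qed.

Lemma mulmx_vec3 (N : 'M[R]_n) a b c v :
  (N *m vec3 a b c) v 0 = N v x * a + N v y * b + N v z * c.
Proof.
have coldelta u : (N *m delta_mx u 0 : 'cV[R]_n) v 0 = N v u.
  rewrite mxE (bigD1 u) //= big1 ?addr0 => [|k /negPf ku].
    by rewrite mxE !eqxx mulr1.
  by rewrite mxE ku mulr0.
have addE (w w' : 'cV[R]_n) : (w + w') v 0 = w v 0 + w' v 0 by rewrite mxE.
have scaleE k (w : 'cV[R]_n) : (k *: w) v 0 = k * w v 0 by rewrite mxE.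
by rewrite !mulmxDr -!scalemxAr !addE !scaleE !coldelta; ring.
Qed.

Lemma sqnorm_vec3 a b c : sqnorm (vec3 a b c) = a ^+ 2 + b ^+ 2 + c ^+ 2.
Proof.
rewrite /sqnorm (bigD1 x) //= (bigD1 y) 1?eq_sym //= (bigD1 z) /=; last first.
  by rewrite ![z == _]eq_sym xz yz.
rewrite vec3x vec3y vec3z big1 ?addr0 ?addrA // => v /andP[/andP[vx vy] vz].
by rewrite vec3E (negPf vx) (negPf vy) (negPf vz) expr0n.
Qed.

Lemma vec3_comb a1 b1 c1 a2 b2 c2 a3 b3 c3 (k1 k2 k3 : R) :
  k1 *: vec3 a1 b1 c1 + (k2 *: vec3 a2 b2 c2 + k3 *: vec3 a3 b3 c3) =
  vec3 (k1 * a1 + k2 * a2 + k3 * a3) (k1 * b1 + k2 * b2 + k3 * b3)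
       (k1 * c1 + k2 * c2 + k3 * c3).
Proof. by rewrite /vec3; apply/colP => v; rewrite !mxE; ring. Qed.

Variables (A : 'M[R]_n) (a : nat).
Hypotheses (a_gt0 : (0 < a)%N) (A_sym : A^T = A) (A_ge0 : forall i j, 0 <= A i j).
Hypothesis S_far : forall u v, u \in S -> v \in S -> u != v ->
  forall l, (l < a)%N -> (A ^+ l) u v = 0.
Hypothesis S_cospectral : forall u, u \in S ->
  forall k, (k <= a)%N -> (A ^+ k) x x = (A ^+ k) u u.
Hypothesis yz_far : (A ^+ a) y z = 0.
Hypothesis xy_gt0 : 0 < (A ^+ a) x y.
Hypothesis xz_ge0 : 0 <= (A ^+ a) x z.
Local Notation Hq Q := (1%:M - A - Q *: W).

Lemma three_wells : exists r P P' K (q : R -> R), let scale := fun Q => q Q ^+ a.-1 in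
  [/\ [/\ 0 < r, (A ^+ a) x y = r * P, (A ^+ a) x z = r * P' & P ^+ 2 + P' ^+ 2 = 1],
      forall Q, 1 <= Q -> Q ^+ a.-1 <= scale Q <= K * Q ^+ a.-1,
      tunnels_to (fun Q t => prob (Hq Q) x y t) scale (P ^+ 2)
        (fun tau => (P * sin (r * tau)) ^+ 2),
      tunnels_to (fun Q t => prob (Hq Q) x z t) scale (P' ^+ 2)
        (fun tau => (P' * sin (r * tau)) ^+ 2) &
      tunnels_to (fun Q t => prob (Hq Q) y z t) scale ((2 * P * P') ^+ 2)
        (fun tau => (P * P' * (cos (r * tau) - 1)) ^+ 2)].
Proof.
pose p := (A ^+ a) x y; pose p' := (A ^+ a) x z; rewrite -/p -/p'.
have p_gt0 : 0 < p := xy_gt0; have p'_ge0 : 0 <= p' := xz_ge0.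
pose r := Num.sqrt (p ^+ 2 + p' ^+ 2).
have pp_gt0 : 0 < p ^+ 2 + p' ^+ 2 by rewrite ltr_pwDl ?exprn_gt0 // sqr_ge0.
have r0 : 0 < r by rewrite sqrtr_gt0.
pose P := p / r; pose P' := p' / r.
have pE : p = r * P by rewrite /P mulrC divfK // gt_eqF.
have p'E : p' = r * P' by rewrite /P' mulrC divfK // gt_eqF.
have P2 : P ^+ 2 + P' ^+ 2 = 1.
  rewrite /P /P' !expr_div_n -mulrDl sqr_sqrtr ?(ltW pp_gt0) //.
  by rewrite divff // gt_eqF.
have P_ge0 : 0 <= P by rewrite divr_ge0 // ltW.
have P'_ge0 : 0 <= P' by rewrite divr_ge0 // ltW.
clearbody P P' r.
pose B := avoidmx S A; pose tau k := (A * B ^+ k) x x.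
have tau_ge0 k : 0 <= tau k by have /andP[] := mul_avoidmx_bounds S A_ge0 k x x.
have /choice[q qP] : forall Q : R, exists q : R, 1 <= Q ->
    Q <= q <= Q + \sum_(k < a) tau k /\
    q - Q = \sum_(k < a) tau k * q^-1 ^+ k.
  move=> Q; case: (pselect (1 <= Q)) => [Q1|nQ1]; last by exists 0.
  by have [q ?] := @renormalized_potential R a tau (fun k _ => tau_ge0 k) Q Q1; exists q.
have qQ Q : 1 <= Q -> Q <= q Q by move=> /qP[/andP[]].
pose T := \sum_(k < a) tau k.
have T0 : 0 <= T by exact: sumr_ge0.
(* For [Q >= 1] one has [q <= Q + T <= (1 + T) * Q], which explains the constant. *)
exists r, P, P', ((1 + T) ^+ a.-1), q => /=.
pose sg : R := (Num.sqrt 2)^-1.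
have sg2 : sg * sg = 2^-1.
  by rewrite -expr2 exprVn sqr_sqrtr.
clearbody sg.
(* The coupling matrix joins [x] to [P y + P' z] with strength [r]. Its eigenvectors are the
   symmetric and antisymmetric combinations of these two unit vectors, and the vector [P' y - P z],
   which is decoupled from [x]. *)
pose s (i : 'I_3) : 'cV[R]_n := match val i with
  | 0%N => vec3 sg (sg * P) (sg * P')
  | 1%N => vec3 sg (- (sg * P)) (- (sg * P'))
  | _ => vec3 0 P' (- P) end.
pose theta (i : 'I_3) : R := match val i with 0%N => r | 1%N => - r | _ => 0 end.
have offdiag k u v : (k < a)%N -> u \in S -> v \in S -> u != v ->
    (A * B ^+ k) u v = (k == a.-1)%:R * (A ^+ a) u v.
  move=> ka uS vS uv; rewrite (mul_avoidmx_offdiag A_ge0 S_far) //.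
  case: eqVneq => [->|ka1]; first by rewrite prednK // mul1r.
  rewrite mul0r S_far // -[X in (_ < X)%N](prednK a_gt0) ltnS ltn_neqAle ka1.
  by rewrite -ltnS prednK.
have [xS yS zS] : [/\ x \in S, y \in S & z \in S] by rewrite !inE !eqxx !orbT.
have diag k u : (k < a)%N -> u \in S -> (A * B ^+ k) u u = tau k.
  by move=> ka uS; apply/esym/(mul_avoidmx_diag S_far xS uS (S_cospectral uS)).
have symA u v := symmetric_expr a A_sym u v.
(* Between the wells, order [k] is the scalar [tau k], joined at [k = a.-1] by the coupling matrix;
   its entry at [(y, z)] vanishes by [yz_far]. *)
have W_vec3 k b c d : (k < a)%N -> W *m ((A * B ^+ k) *m vec3 b c d) =
   tau k *: vec3 b c d +
   ((k == a.-1)%:R * r) *: vec3 (P * c + P' * d) (P * b) (P' * b).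
  move=> ka; rewrite potW_vec3 !mulmx_vec3 !diag // !offdiag // 1?eq_sym //.
  rewrite [(A ^+ a) y x]symA [(A ^+ a) z x]symA [(A ^+ a) z y]symA yz_far.
  rewrite -/p -/p' pE p'E /vec3; apply/colP => v; rewrite !mxE; ring.
have Ws i : W *m s i = s i.
  by rewrite potW_vec3 /s; case: i => -[|[|i]] ?; rewrite /= vec3x vec3y vec3z.
have s_unit i : sqnorm (s i) = 1.
  have e : (sg * P) ^+ 2 + (sg * P') ^+ 2 = 2^-1.
    by rewrite !exprMn -mulrDr P2 mulr1 expr2.
  rewrite /s; case: i => -[|[|i]] ? /=; rewrite sqnorm_vec3.
  - by rewrite -addrA e expr2 sg2; lra.
  - by rewrite !sqrrN -addrA e expr2 sg2; lra.
  - by rewrite sqrrN expr0n add0r addrC.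
have s_eigen i k : (k < a)%N ->
    W *m ((A * avoidmx S A ^+ k) *m s i) = (tau k + (k == a.-1)%:R * theta i) *: s i.
  move=> ka; rewrite scalerDl -scalerA /s /theta.
  have PPsg : P * (sg * P) + P' * (sg * P') = sg.
    by rewrite -[RHS]mulr1 -P2; ring.
  case: i => -[|[|i]] ? /=; rewrite W_vec3 //; congr (_ + _); rewrite -scalerA; congr (_ *: _).
  - by rewrite PPsg ![_ * sg]mulrC.
  - rewrite !mulrN -opprD PPsg ![_ * sg]mulrC /vec3.
    by apply/colP => v; rewrite !mxE; ring.
  - by rewrite scale0r /vec3; apply/colP => v; rewrite !mxE; ring.
have gap i k : i != k -> r <= `|theta i - theta k|.
  have r2 : r <= `|r - - r| by rewrite opprK ger0_norm; lra.
  have r1 : r <= `|r - 0| by rewrite subr0 ler_norm.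
  have r3 : r <= `|- r - 0| by rewrite subr0 normrN ler_norm.
  rewrite /theta; case: i => -[|[|[|i]]] // ?; case: k => -[|[|[|k]]] // ? //= _;
  by rewrite // distrC.
have expandx : delta_mx x 0 = \sum_i s i x 0 *: s i.
  rewrite !big_ord_recl big_ord0 addr0 /s /= !vec3x vec3_comb.
  have -> : delta_mx x 0 = vec3 1 0 0 by rewrite /vec3 scale1r !scale0r !addr0.
  by congr vec3; rewrite ?sg2; (lra || ring).
have expandy : delta_mx y 0 = \sum_i s i y 0 *: s i.
  rewrite !big_ord_recl big_ord0 addr0 /s /= !vec3y vec3_comb.
  have -> : delta_mx y 0 = vec3 0 1 0 by rewrite /vec3 scale1r !scale0r addr0 add0r.
  congr vec3; first by ring.
    rewrite -[LHS]P2 -[P ^+ 2]mul1r (_ : 1 = 2 * (sg * sg)); first by ring.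
    by rewrite sg2; lra.
  apply/esym; rewrite (_ : _ + _ = P * P' * (2 * (sg * sg) - 1)); last by ring.
  by rewrite sg2; lra.
have expandz : delta_mx z 0 = \sum_i s i z 0 *: s i.
  rewrite !big_ord_recl big_ord0 addr0 /s /= !vec3z vec3_comb.
  have -> : delta_mx z 0 = vec3 0 0 1 by rewrite /vec3 scale1r !scale0r !add0r.
  congr vec3; first by ring.
    apply/esym; rewrite (_ : _ + _ = P * P' * (2 * (sg * sg) - 1)); last by ring.
    by rewrite sg2; lra.
  rewrite -[LHS]P2 -[P' ^+ 2]mul1r (_ : 1 = 2 * (sg * sg)); first by ring.
  by rewrite sg2; lra.
have main u v : v \in S -> delta_mx u 0 = \sum_i s i u 0 *: s i ->
    delta_mx v 0 = \sum_i s i v 0 *: s i ->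
    tunnels_to (fun Q t => prob (Hq Q) u v t) (fun Q => q Q ^+ a.-1)
      ((\sum_i `|s i u 0 * s i v 0|) ^+ 2)
      (fun t => (\sum_i s i u 0 * s i v 0 * cos (theta i * t)) ^+ 2 +
                (\sum_i s i u 0 * s i v 0 * sin (theta i * t)) ^+ 2).
  move=> vS uE vE.
  have [C C0 hC] := quasimode_prob a_gt0 A_sym Ws s_unit s_eigen r0 gap vS uE vE.
  apply: (@quasimode_tunnels_to R _ _ _ _ (fun i => s i u 0 * s i v 0) theta C C0 qQ).
  move=> Q Q1; apply: hC; first exact: le_trans Q1 (qQ _ Q1).
  by have [_] := qP _ Q1.
have sgsgM (b c : R) : sg * b * (sg * c) = b * c / 2.
  by rewrite mulrACA sg2 mulrC.
have sgM (b : R) : sg * (sg * b) = b / 2 by rewrite mulrA sg2 mulrC.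
have sum_half (b : R) : 0 <= b -> `|b / 2| + (`|b / 2| + (0 + 0)) = b.
  by move=> b0; rewrite !addr0 ger0_norm ?divr_ge0 //; lra.
split.
- by split.
- move=> Q Q1; have /andP[h1 h2] := (qP _ Q1).1.
  have Q0 : 0 <= Q by exact: le_trans ler01 Q1.
  rewrite -exprMn; apply/andP; split; apply: lerXn2r; rewrite ?nnegrE //.
  + exact: le_trans h1.
  + exact: le_trans h1.
  + by rewrite mulr_ge0 // addr_ge0.
  + by apply: le_trans h2 _; rewrite mulrDl mul1r lerD2l ler_peMr.
(* From [x] the weights are [P / 2] and [- P / 2] at energies [r] and [- r]: the cosines cancel and
   the sines add. *)
- have := main _ _ yS expandx expandy.
  rewrite !big_ord_recl !big_ord0 /s /= !vec3x !vec3y.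
  rewrite mulrN !normrN !sgM mul0r normr0 sum_half //.
  congr (tunnels_to _ _ _ _); apply/funext => t.
  rewrite !big_ord_recl !big_ord0 /s /theta /= !vec3x !vec3y !mulrN !sgM !mulNr cosN sinN.
  by rewrite -[RHS]add0r; congr (_ + _); [ring | field].
- have := main _ _ zS expandx expandz.
  rewrite !big_ord_recl !big_ord0 /s /= !vec3x !vec3z.
  rewrite mulrN !normrN !sgM mul0r normr0 sum_half //.
  congr (tunnels_to _ _ _ _); apply/funext => t.
  rewrite !big_ord_recl !big_ord0 /s /theta /= !vec3x !vec3z !mulrN !sgM !mulNr cosN sinN.
  by rewrite -[RHS]add0r; congr (_ + _); [ring | field].
(* Here the weights at [r] and [- r] are both [P * P' / 2], so the sines cancel; the decoupled
   vector contributes the constant [- P * P']. *)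
- have := main _ _ zS expandy expandz.
  rewrite !big_ord_recl !big_ord0 /s /= !vec3y !vec3z.
  have PP0 : 0 <= P * P' by exact: mulr_ge0.
  rewrite mulrNN mulrN normrN !sgsgM [`|P' * P|]ger0_norm ?mulr_ge0 //.
  rewrite (_ : _ + _ = 2 * P * P'); last first.
    by rewrite !ger0_norm ?divr_ge0 //; lra.
  congr (tunnels_to _ _ _ _); apply/funext => t.
  rewrite !big_ord_recl !big_ord0 /s /theta /= !vec3y !vec3z mulrNN !sgsgM.
  rewrite !mulNr cosN sinN mul0r cos0 sin0 -[RHS]addr0.
  by congr (_ + _); [field | ring].
Qed.

End ThreeWells.

(** * The three regimes of distances between the wells *)

Theorem theorem2 (R : realType) (n : nat) (e : rel 'I_n)
  (Hsimple : simple_graph e) (Hconn : connected_graph e)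
  (x y z : 'I_n) (Hxy : x != y) (Hxz : x != z) (Hyz : y != z)
  (Hab : (gdist e x y <= gdist e x z)%N) (Hbc : (gdist e x z <= gdist e y z)%N)
  (Hcxy : cospectral e R (gdist e y z) x y)
  (Hcxz : cospectral e R (gdist e y z) x z)
  (Hcyz : cospectral e R (gdist e y z) y z) :
  let a := gdist e x y in
  let b := gdist e x z in
  let c := gdist e y z in
  let S := [:: x; y; z] in
  let g := fun Q : R => Q ^+ a.-1 in
  (* (1) *)
  ((a < b)%N ->
     TC e R S x y = 1%:E /\ TC e R S y x = 1%:E /\
     tunnel_time e S x y g /\ tunnel_time e S y x g /\
     TC e R S x z = 0%:E /\ TC e R S z x = 0%:E /\
     TC e R S y z = 0%:E /\ TC e R S z y = 0%:E) /\
  (* (2) *)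
  (a = b -> (b < c)%N ->
     (TC e R S x y < 1%:E)%E /\ (TC e R S x z < 1%:E)%E /\
     TCgen (fun Q t : R => prob (ham e S Q) x y t + prob (ham e S Q) x z t) = 1%:E /\
     tunnel_time_gen (fun Q t : R => prob (ham e S Q) x y t + prob (ham e S Q) x z t) g) /\
  (* (3) *)
  (a = b -> (b < c)%N ->
     (TC e R S y z = 1%:E <-> cpath e R x y = cpath e R x z) /\
     (cpath e R x y = cpath e R x z -> tunnel_time e S y z g)).
Proof.
move=> a b c S g; have [e_sym e_irr] := Hsimple.
pose A := adjmx e R.
have A_sym : A^T = A := adjmx_sym R e_sym.
have symA l u v := symmetric_expr l A_sym u v.
have a_gt0 : (0 < a)%N := gdist_gt0 (Hconn x y) Hxy.
have ac : (a <= c)%N := leq_trans Hab Hbc.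
have p_gt0 : 0 < (A ^+ a) x y by rewrite -cpathE cpath_gt0.
have HqE (Q : R) : ham e S Q = 1%:M - A - Q *: potW R S by rewrite /ham laplacianE.
have probC (Q : R) u v t : prob (ham e S Q) u v t = prob (ham e S Q) v u t.
  apply: prob_sym; rewrite HqE !raddfB /= trmx1 A_sym linearZ /=.
  by rewrite trmx_potW.
have TCC u v : TC e R S u v = TC e R S v u.
  by rewrite /TC; congr TCgen; apply/funext => Q; apply/funext => t.
have timeC u v : tunnel_time e S u v g = tunnel_time e S v u g.
  by rewrite /tunnel_time; congr tunnel_time_gen; apply/funext => Q; apply/funext => t.
have S_far u v : u \in S -> v \in S -> u != v ->
    forall l, (l < a)%N -> (A ^+ l) u v = 0.
  have far l : (l < a)%N ->
      [/\ (A ^+ l) x y = 0, (A ^+ l) x z = 0 & (A ^+ l) y z = 0].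
    by move=> la; split; apply: adjmx_expr_lt_gdist => //;
      apply: (leq_trans la); [exact: Hab|exact: ac].
  rewrite !inE => /or3P[] /eqP-> /or3P[] /eqP->; rewrite ?eqxx // => _ l /far[? ? ?];
  by [|rewrite symA].
have S_cosp u : u \in S -> forall k, (k <= a)%N -> (A ^+ k) x x = (A ^+ k) u u.
  have cosp v : cospectral e R c x v -> forall k, (k <= a)%N ->
      (A ^+ k) x x = (A ^+ k) v v.
    move=> h k ka; rewrite -!(PR_adjmx R _ _ Hconn Hxy); apply: h.
    exact: leq_trans ka ac.
  rewrite !inE => /or3P[] /eqP-> //; exact: cosp.
have far_cases : (a < b)%N \/ a = b /\ (b < c)%N -> (a < c)%N.
  by case=> [ab|[-> //]]; exact: leq_trans ab Hbc.
have key : (a < c)%N -> exists r P P' K (q : R -> R), let scale := fun Q => q Q ^+ a.-1 in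
  [/\ [/\ 0 < r, (A ^+ a) x y = r * P, (A ^+ a) x z = r * P' & P ^+ 2 + P' ^+ 2 = 1],
      forall Q, 1 <= Q -> Q ^+ a.-1 <= scale Q <= K * Q ^+ a.-1,
      tunnels_to (fun Q t => prob (ham e S Q) x y t) scale (P ^+ 2)
        (fun tau => (P * sin (r * tau)) ^+ 2),
      tunnels_to (fun Q t => prob (ham e S Q) x z t) scale (P' ^+ 2)
        (fun tau => (P' * sin (r * tau)) ^+ 2) &
      tunnels_to (fun Q t => prob (ham e S Q) y z t) scale ((2 * P * P') ^+ 2)
        (fun tau => (P * P' * (cos (r * tau) - 1)) ^+ 2)].
  move=> /(adjmx_expr_lt_gdist R) yz0.
  (* Taken at [k = a.-1], the bounds for avoiding walks enclose 0 below this power of [A]. *)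
  have xz0 : 0 <= (A ^+ a) x z.
    have := mul_avoidmx_bounds S (@adjmx_ge0 _ e R) a.-1 x z.
    by rewrite prednK // => /andP[]; exact: le_trans.
  have := three_wells Hxy Hxz Hyz a_gt0 A_sym (@adjmx_ge0 _ e R) S_far S_cosp yz0
    p_gt0 xz0.
  by move=> [r [P [P' [K [q h]]]]]; exists r, P, P', K, q => /=;
    under eq_fun do rewrite HqE; under [X in tunnels_to X _ (P' ^+ 2)]eq_fun do rewrite HqE;
    under [X in tunnels_to X _ ((2 * _ * _) ^+ 2)]eq_fun do rewrite HqE.
have sin_peak (r : R) : 0 < r -> 0 <= pi / 2 / r /\ sin (r * (pi / 2 / r)) = 1.
  move=> r0; split; first by rewrite !divr_ge0 ?pi_ge0 // ltW.
  by rewrite mulrC divfK ?gt_eqF // sin_pihalf.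
have cos_peak (r : R) : 0 < r -> 0 <= pi / r /\ cos (r * (pi / r)) = -1.
  move=> r0; split; first by rewrite divr_ge0 ?pi_ge0 // ltW.
  by rewrite mulrC divfK ?gt_eqF // cospi.
have sin_sqr_le (r tau : R) : 0 < r -> 0 <= tau -> sin (r * tau) ^+ 2 <= r * tau.
  move=> r0 tau0; have h0 : 0 <= r * tau by rewrite mulr_ge0 // ltW.
  rewrite -real_normK ?num_real // expr2.
  apply: (@le_trans _ _ `|sin (r * tau)|); first by rewrite ler_piMl // sin_max.
  by have := ler_dist_sin (r * tau) 0; rewrite sin0 !subr0 (ger0_norm h0).
have cos_sqr_le (r tau : R) : 0 < r -> 0 <= tau ->
    (cos (r * tau) - 1) ^+ 2 <= 2 * r * tau.
  move=> r0 tau0; have h0 : 0 <= r * tau by rewrite mulr_ge0 // ltW.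
  rewrite -real_normK ?num_real // expr2 -mulrA.
  have := ler_dist_cos (r * tau) 0; rewrite cos0 !subr0 (ger0_norm h0).
  apply: ler_pM => //; rewrite ler_norml.
  by have := cos_geN1 (r * tau); have := cos_le1 (r * tau); lra.
split; last split.
- move=> ab; have [r [P [P' [K [q /= [[r0 pE p'E P2] sc txy txz tyz]]]]]] :=
    key (far_cases (or_introl ab)).
  (* No walk of length [a < b] joins [x] to [z], so [z] decouples and the ceilings for it become 0,
     attained already at time 0. *)
  have P'0 : P' = 0.
    move: p'E; rewrite (adjmx_expr_lt_gdist R ab) => /esym/eqP.
    by rewrite mulf_eq0 gt_eqF //= => /eqP.
  have Psq : P ^+ 2 = 1 by rewrite -P2 P'0 expr0n addr0.
  have [t0 s1] := sin_peak r r0.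
  rewrite P'0 mulr0 !expr0n /= in txz tyz; rewrite Psq in txy.
  have TCxy : TC e R S x y = 1%:E.
    by apply: (tunnels_to_TC txy sc t0); rewrite s1 mulr1.
  have Txy : tunnel_time e S x y g.
    apply: (tunnels_to_time txy sc t0) (ltr01) (ltW r0) _; rewrite ?s1 ?mulr1 //.
    by move=> tau tau0; rewrite exprMn Psq mul1r sin_sqr_le.
  have TCxz : TC e R S x z = 0%:E.
    by apply: (tunnels_to_TC txz sc (lexx 0)); rewrite mul0r expr0n.
  have TCyz : TC e R S y z = 0%:E.
    by apply: (tunnels_to_TC tyz sc (lexx 0)); rewrite mulr0 mul0r expr0n.
  by rewrite [TC _ _ _ y x]TCC [TC _ _ _ z x]TCC [TC _ _ _ z y]TCC
    [tunnel_time _ _ y x _]timeC.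
- move=> ab bc; have [r [P [P' [K [q /= [[r0 pE p'E P2] sc txy txz tyz]]]]]] :=
    key (far_cases (or_intror (conj ab bc))).
  have p'_gt0 : 0 < (A ^+ a) x z by rewrite ab -cpathE cpath_gt0.
  have P0 : 0 < P by move: p_gt0; rewrite pE pmulr_rgt0.
  have P'0 : 0 < P' by move: p'_gt0; rewrite p'E pmulr_rgt0.
  have [t0 s1] := sin_peak r r0.
  have TCxy : TC e R S x y = (P ^+ 2)%:E.
    by apply: (tunnels_to_TC txy sc t0); rewrite s1 mulr1.
  have TCxz : TC e R S x z = (P' ^+ 2)%:E.
    by apply: (tunnels_to_TC txz sc t0); rewrite s1 mulr1.
  (* Both couplings are positive and the squares of [P] and [P'] add up to 1, so neither square
     reaches 1, while the summed probabilities peak together. *)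
  rewrite TCxy TCxz !lte_fin -P2 ltrDl ltrDr !exprn_gt0 //.
  have tsum := tunnels_toD txy txz; rewrite P2 in tsum; rewrite P2.
  have peak : (P * sin (r * (pi / 2 / r))) ^+ 2 + (P' * sin (r * (pi / 2 / r))) ^+ 2 = 1.
    by rewrite s1 !mulr1.
  do 3!split => //; first exact: (tunnels_to_TC tsum sc t0).
  apply: (tunnels_to_time tsum sc t0) ltr01 (ltW r0) _ => // tau tau0.
  by rewrite !exprMn -mulrDl P2 mul1r sin_sqr_le.
- move=> ab bc; have [r [P [P' [K [q /= [[r0 pE p'E P2] sc txy txz tyz]]]]]] :=
    key (far_cases (or_intror (conj ab bc))).
  have p'_gt0 : 0 < (A ^+ a) x z by rewrite ab -cpathE cpath_gt0.
  have P0 : 0 < P by move: p_gt0; rewrite pE pmulr_rgt0.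
  have P'0 : 0 < P' by move: p'_gt0; rewrite p'E pmulr_rgt0.
  have [t0 c1] := cos_peak r r0.
  have peak : (P * P' * (cos (r * (pi / r)) - 1)) ^+ 2 = (2 * P * P') ^+ 2.
    by rewrite c1; ring.
  have TCyz : TC e R S y z = ((2 * P * P') ^+ 2)%:E.
    exact: (tunnels_to_TC tyz sc t0).
  have cE : cpath e R x y = cpath e R x z <-> P = P'.
    rewrite !cpathE -/A -/a -/b -ab pE p'E; split => [/mulfI-> //|-> //].
    by rewrite gt_eqF.
  have PP'0 : 0 < 2 * P * P' by rewrite !mulr_gt0.
  rewrite TCyz; split.
    split => [[/eqP]|/cE PP'].
      rewrite sqrp_eq1 ?(ltW PP'0) // => /eqP PP'; apply/cE/eqP.
      (* Since the squares sum to 1, [2 * P * P' = 1] is equivalent to [(P - P') ^+ 2 = 0]. *)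
      rewrite -subr_eq0 -sqrf_eq0 (_ : _ ^+ 2 = P ^+ 2 + P' ^+ 2 - 2 * P * P').
        by rewrite P2 PP' subrr.
      by ring.
    congr (_%:E); rewrite (_ : 2 * P * P' = 1) ?expr1n //.
    by move: P2; rewrite -PP' expr2; lra.
  move=> _; apply: (@tunnels_to_time _ _ _ _ _ tyz _ _ sc _ t0 peak
    ((P * P') ^+ 2 * (2 * r))).
  + by rewrite exprn_gt0.
  + by rewrite mulr_ge0 ?sqr_ge0 // mulr_ge0 // ltW.
  + move=> tau tau0; rewrite exprMn -[leRHS]mulrA.
    by apply: ler_wpM2l; [exact: sqr_ge0|exact: cos_sqr_le].
Qed.
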